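(* Let $G=(V,E)$ be a finite connected multigraph with no loops, and let $L_n(G)$ denote a random $n$-lift of $G$. Then almost surely \[ \lim_{n\to \infty}\frac{1}{n} \nu(L_n(G)) = \nu^*(G), \] and for every $z>0$, almost surely \[ \lim_{n\to \infty}\frac{1}{n}\ln P_{L_n(G)}(z)= \max_{\mathbf{x} \in FM(G)} \Big\{\Big( \sum_{e\in E} x_e\Big)\ln z+S^B_G(\mathbf{x})\Big\}. \] Moreover, \[ \limsup_{n\to \infty} \frac{1}{n} \ln m_{\nu(L_n(G))}(L_n(G)) \leq\sup_{\mathbf{x}\in FPM(G)}S^B_G(\mathbf{x}). \] If in addition $G$ is bipartite, then $FPM(G)=PM(G)$ and \[ \lim_{n\to \infty} \frac{1}{n} \ln m_{\nu(L_n(G))}(L_n(G)) =\sup_{\mathbf{x}\in PM(G)}S^B_G(\mathbf{x}). \]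
   Context: A random $n$-lift $L_n(G)$ of $G$ is the random graph on vertex set $V_1\cup\dots\cup V_{v(G)}$, where each $V_i$ is a set of $n$ vertices (pairwise disjoint, one set per vertex $i$ of $G$), obtained by placing a uniformly chosen random perfect matching between $V_i$ and $V_j$, independently for each edge $e=ij$ of $G$. For a graph $H$: a matching is a set of pairwise vertex-disjoint edges, $m_k(H)$ is the number of matchings of size $k$, $\nu(H)$ the maximum matching size, $P_H(z)=\sum_k m_k(H)z^k$. For a vertex $v$, $\partial v$ is the set of edges incident to $v$. $FM(G)=\{\mathbf{x}\in\mathbb{R}^E: x_e\ge 0,\ \sum_{e\in\partial v}x_e\le 1\ \forall v\}$ and $\nu^*(G)=\max_{\mathbf{x}\in FM(G)}\sum_e x_e$. For $t\ge0$, $FM_t(G)=\{\mathbf{x}\in FM(G):\sum_e x_e=t\}$, and $FPM(G)=FM_{\nu^*(G)}(G)$. $PM(G)$ denotes the convex hull of the incidence vectors of maximum matchings of $G$. For $\mathbf{x}\in FM(G)$, \[ S^B_G(\mathbf{x})=\sum_{e\in E}\big( -x_e\ln x_e +(1-x_e)\ln (1-x_e)\big) - \sum_{v\in V}\Big( 1-\sum_{e\in \partial v} x_e\Big)\ln\Big( 1-\sum_{e\in \partial v}x_e\Big), \] with $0\ln 0=0$. *)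

(* Defs.v *)
From HB Require Import structures.
From mathcomp Require Import all_boot all_order all_algebra all_fingroup.
From mathcomp Require Import all_classical all_reals all_analysis.
Set Implicit Arguments. Unset Strict Implicit. Unset Printing Implicit Defensive.
Import Order.TTheory GRing.Theory Num.Theory.
Local Open Scope classical_set_scope.
Local Open Scope ring_scope.

(* A finite multigraph: vertex type V, edge type E, each edge e has
   endpoints ends e = (i, j).  Parallel edges allowed (ends not injective). *)
Section Graphs.
Variables (V E : finType) (ends : E -> V * V).

Definition loopless := forall e : E, (ends e).1 != (ends e).2.

Definition adj : rel V :=
  fun u v => [exists e : E, (ends e == (u, v)) || (ends e == (v, u))].

Definition connected_graph := forall u v : V, connect adj u v.

Definition bipartite_graph :=
  exists c : V -> bool, forall e : E, c (ends e).1 != c (ends e).2.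

Definition incident (v : V) (e : E) : bool :=
  ((ends e).1 == v) || ((ends e).2 == v).

Definition is_matching (M : {set E}) : bool :=
  [forall e in M, forall f in M,
     (e != f) ==> [forall v : V, ~~ (incident v e && incident v f)]].

Definition nmatch (k : nat) : nat :=
  #|[set M : {set E} | is_matching M & #|M| == k]|.

Definition match_num : nat := \max_(M : {set E} | is_matching M) #|M|.

Definition max_matching (M : {set E}) : bool :=
  is_matching M && (#|M| == match_num).

(* P_H(z) = sum_k m_k(H) z^k  (m_k = 0 for k > |E|) *)
Definition match_poly (R : ringType) (z : R) : R :=
  \sum_(k < #|E|.+1) (nmatch k)%:R * z ^+ k.

Section Fractional.
Variable R : realType.

Definition vsum (x : E -> R) (v : V) : R := \sum_(e | incident v e) x e.

Definition edge_sum (x : E -> R) : R := \sum_(e : E) x e.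

Definition FM : set (E -> R) :=
  [set x | (forall e, 0 <= x e) /\ (forall v, vsum x v <= 1)].

Definition nu_star : R := sup [set edge_sum x | x in FM].

Definition FM_t (t : R) : set (E -> R) := [set x | FM x /\ edge_sum x = t].
Definition FPM : set (E -> R) := FM_t nu_star.

Definition PM : set (E -> R) :=
  [set x | exists lam : {set E} -> R,
     [/\ (forall M, 0 <= lam M),
         (forall M, ~~ max_matching M -> lam M = 0),
         \sum_(M : {set E}) lam M = 1 &
         x = (fun e => \sum_(M : {set E}) lam M * (e \in M)%:R)]].

Definition xlnx (a : R) : R := if a == 0 then 0 else a * ln a.

Definition bethe (x : E -> R) : R :=
  \sum_(e : E) (- xlnx (x e) + xlnx (1 - x e)) - \sum_(v : V) xlnx (1 - vsum x v).

End Fractional.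
End Graphs.

(* n-lifts: an n-lift of G is given by, for each edge e = (i,j), a bijection
   sigma_e : V_i -> V_j (V_i = {i} x 'I_n), i.e. a perfect matching between
   V_i and V_j.  A uniformly random n-lift is a uniform element of this finite
   type (independent uniform perfect matchings on the edges). *)
Definition nlift (E : finType) (n : nat) := {ffun E -> {perm 'I_n}}.

Definition lift_ends (V E : finType) (ends : E -> V * V) (n : nat)
  (s : nlift E n) : E * 'I_n -> (V * 'I_n) * (V * 'I_n) :=
  fun p => (((ends p.1).1, p.2), ((ends p.1).2, s p.1 p.2)).

(* Main.v *)
(* The first moment of the number of matchings with n x_e edges over each edge e
   of G is exp(n S^B(x) + O(ln n)), which with Markov's inequality and
   Borel-Cantelli gives all upper bounds.

   For the lower bounds, on every bipartite graph H the deterministic inequality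
   ln P_H(z) >= (sum_e x_e) ln z + S^B_H(x) holds for all x in FM(H).  It is
   obtained by adding the edges one at a time in a capacity argument a la
   Gurvits: the needed two-variable inequality only requires that
   Z(H) Z(H-u-v) >= Z(H-u) Z(H-v) for u, v on opposite sides.

   If G is not bipartite, this is applied to the bipartite double cover D of the
   lift L.  Pairs of matchings of L correspond to those matchings of D whose
   projection to L has no odd cycle.  A random lift has few short cycles, and
   there is no room for many disjoint long ones, so that deleting o(n) edges
   removes all odd cycles and P_D(z) <= exp(o(n)) P_L(z)^2. *)
Require Import Defs.
From HB Require Import structures.
From mathcomp Require Import all_boot all_order all_algebra all_fingroup.
From mathcomp Require Import all_classical all_reals all_analysis.
From mathcomp Require Import lra ring zify.
Set Implicit Arguments. Unset Strict Implicit. Unset Printing Implicit Defensive.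
Import Order.TTheory GRing.Theory Num.Theory.
Import numFieldNormedType.Exports.
Local Open Scope classical_set_scope.
Local Open Scope ring_scope.

(** * Matchings with vertex weights *)

(** Pulling a point [x] of [FM] back to an [n]-lift multiplies its Bethe entropy by [n]. The
    deterministic bound on the lift therefore has the very exponent of the first moment, and no
    second moment of matchings is needed. Randomness enters only through the two almost sure
    properties collected in [typical]; every limit is then taken along one fixed typical sequence of
    lifts.

    The obstacle outside the bipartite case is the sign of the correlation: the capacity step needs
    removing [u] and [v] together to be favourable for every edge [uv], which is what a 2-colouring
    provides. Passing to the double cover restores it, at the price of comparing two kinds of
    doubled structures on the lift.

    Matching numbers need no separate theory. Letting [z] grow in the same bounds gives the limit of
    [nu(L) / n], and, for bipartite graphs, integrality of [nu_star] and a lower bound on the number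
    of maximum matchings. Edge weights [exp (T w)] with [T] large give [FPM = PM]. *)

Section WeightedMatchings.
Variables (R : realType) (V E : finType) (ends : E -> V * V).
Variable lam : E -> R.
Hypothesis lam_gt0 : forall e, 0 < lam e.

Local Notation a e := (ends e).1.
Local Notation b e := (ends e).2.

(** Monomer-dimer partition function of the graph induced on [U] with edge list [s]: an uncovered
    vertex [v] pays [Y v]. Recursion on the list makes the insertion of an edge definitional, which
    is the step of the capacity argument. *)
Fixpoint wmatch (Y : V -> R) (s : seq E) (U : {set V}) : R :=
  if s is e :: s' then
    wmatch Y s' U + (if (a e \in U) && (b e \in U)
                     then lam e * wmatch Y s' (U :\ a e :\ b e) else 0)
  else \prod_(v in U) Y v.

Definition opposite (u : V) (e : E) : V := if a e == u then b e else a e.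

Lemma wmatch_gt0 Y s U : (forall v, 0 < Y v) -> 0 < wmatch Y s U.
Proof.
move=> Y0; elim: s U => [|e s IH] U /=; first by apply: prodr_gt0.
by apply: ltr_wpDr => //; case: ifP => // _; rewrite mulr_ge0 // ltW.
Qed.

Lemma eq_wmatch Y Y' s (U : {set V}) : {in U, Y =1 Y'} -> wmatch Y s U = wmatch Y' s U.
Proof.
elim: s U => [|e s IH] U YY /=; first by apply: eq_bigr => v vU; exact: YY.
rewrite (IH _ YY) (IH (U :\ a e :\ b e)) // => v; rewrite !inE => /andP[_ /andP[_ vU]].
exact: YY.
Qed.

Lemma setD1AC (T : finType) (A : {set T}) x y : A :\ x :\ y = A :\ y :\ x.
Proof. by rewrite !finset.setDDl finset.setUC. Qed.

(** The partition function is affine in the weight of [u]. The increment [y] behaves like a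
    half-edge at [u]: using it removes [u] from the graph. *)
Lemma wmatch_addw Y s (U : {set V}) u y : u \in U ->
  wmatch (fun v => Y v + (v == u)%:R * y) s U
  = wmatch Y s U + y * wmatch Y s (U :\ u).
Proof.
elim: s U => [|e s IH] U uU /=.
  rewrite (bigD1 u uU) (bigD1 (P := fun v => v \in U) u uU) /= eqxx mul1r.
  have eqp F : \prod_(i in U :\ u) F i = \prod_(i in U | i != u) F i :> R.
    by apply: eq_bigl => i; rewrite !inE andbC.
  rewrite eqp mulrDl; congr (_ * _ + _ * _).
  - by apply: eq_bigr => i /andP[_ /negPf ->]; rewrite mul0r addr0.
  - by apply: eq_bigr => i /andP[_ /negPf ->]; rewrite mul0r addr0.
rewrite (IH _ uU) mulrDr addrACA; congr (_ + _).
case: ifPn => [/andP[aU bU]|abU]; last first.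
  rewrite add0r ifN ?mulr0 //; apply: contra abU.
  by rewrite !inE => /andP[/andP[_ ->] /andP[_ ->]].
case: ifPn => [|].
  rewrite !inE => /andP[/andP[au _] /andP[bu _]].
  rewrite IH ?inE 1?eq_sym ?bu ?[u == _]eq_sym ?au //.
  by rewrite mulrDr mulrCA (setD1AC U u) (setD1AC _ u (b e)).
move=> H; rewrite mulr0 addr0; congr (_ * _); apply: eq_wmatch => v.
rewrite !inE => /and3P[vb va _]; case: eqP => [vu|_]; last by rewrite mul0r addr0.
by move: H; rewrite -vu !inE aU bU [a e == _]eq_sym [b e == _]eq_sym va vb.
Qed.

Lemma wmatch_cons_notin Y f s (U : {set V}) u : incident ends u f -> u \notin U ->
  wmatch Y (f :: s) U = wmatch Y s U.
Proof.
move=> uf uU /=; rewrite ifN ?addr0 //; apply: contra uU => /andP[aU bU].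
by case/orP: uf => /eqP <-.
Qed.

Lemma wmatch_expand Y s (U : {set V}) u : loopless ends -> u \in U ->
  wmatch Y s U = Y u * wmatch Y s (U :\ u) +
   \sum_(e <- s | incident ends u e && (opposite u e \in U))
      lam e * wmatch Y s (U :\ u :\ opposite u e).
Proof.
move=> Hl; elim: s U => [|f s IH] U uU.
  by rewrite big_nil addr0 /= (big_setD1 u uU).
have Hlf := Hl f.
rewrite big_cons [in LHS]/=; case uf: (incident ends u f); last first.
  move: (uf); rewrite /incident => /negbT; rewrite negb_or => /andP[au bu].
  rewrite (IH _ uU) /= !inE au bu mulrDr /=.
  case: ifPn => abU; last first.
    rewrite mulr0 !addr0; congr (_ + _); apply: eq_bigr => e _.
    by rewrite !inE ifN ?addr0 //; apply: contra abU => /andP[/and3P[_ _ ->] /and3P[_ _ ->]].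
  rewrite (IH (U :\ a f :\ b f)) ?inE 1?eq_sym ?bu ?[u == _]eq_sym ?au //.
  rewrite mulrDr addrACA; congr (_ + _).
    by rewrite mulrCA (setD1AC U u) (setD1AC _ u (b f)).
  rewrite mulr_sumr.
  rewrite [X in _ + X = _]big_mkcond /= [X in X + _ = _]big_mkcond /= -big_split [RHS]big_mkcond /=.
  apply: eq_bigr => e _; rewrite !inE -/(incident ends u e) au bu /=.
  case: (incident ends u e) => /=; last by rewrite addr0.
  set w := opposite u e; case wU: (w \in U); last by rewrite !andbF addr0.
  rewrite !andbT [b f == w]eq_sym [a f == w]eq_sym; case/andP: abU => -> ->; rewrite !andbT.
  rewrite [(w != a f) && _]andbC; case: ifP => _; last by rewrite !addr0.
  rewrite mulrDr; congr (_ + _); rewrite mulrCA; congr (_ * (_ * wmatch _ _ _)).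
  apply/setP => i; rewrite !inE; do !case: (_ != _) => //=.
have tailE e : incident ends u e && (opposite u e \in U) ->
    wmatch Y (f :: s) (U :\ u :\ opposite u e) = wmatch Y s (U :\ u :\ opposite u e).
  by move=> _; apply: (wmatch_cons_notin _ _ uf); rewrite !inE eqxx andbF.
rewrite (eq_bigr _ (fun e He => congr1 _ (tailE e He))).
rewrite (wmatch_cons_notin _ _ uf) ?inE ?eqxx // (IH _ uU).
have [-> sE] : (a f \in U) && (b f \in U) = (opposite u f \in U) /\
   U :\ a f :\ b f = U :\ u :\ opposite u f.
  rewrite /opposite; case: (eqVneq (a f) u) => [->|au]; first by rewrite uU.
  by move: uf; rewrite /incident (negPf au) /= => /eqP bu; rewrite bu setD1AC uU andbT.
case: ifP => oU; last by rewrite addr0.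
by rewrite tailE ?uf ?oU // sE -addrA [X in _ + X]addrC.
Qed.

Hypothesis Hl : loopless ends.
Variable col : V -> bool.
Hypothesis Hcol : forall e, col (a e) != col (b e).

Lemma opposite_neq u e : incident ends u e -> opposite u e != u.
Proof.
rewrite /incident /opposite; have := Hl e.
by case: (eqVneq (a e) u) => //= <-; rewrite eq_sym.
Qed.

Lemma col_opposite u e : incident ends u e -> col (opposite u e) = ~~ col u.
Proof.
rewrite /incident /opposite; have := Hcol e; case: (eqVneq (a e) u) => [->|_] /=.
  by move=> + _; case: (col u) (col (b e)) => -[].
by move=> + /eqP <-; case: (col (a e)) (col (b e)) => -[].
Qed.

(* Christoffel-Darboux type recursion: exchanging the role of u with that of
   its neighbours reverses the sign of the defect and removes one vertex. *)
Lemma wmatch_rayleigh Y s (U : {set V}) u v : (forall v, 0 < Y v) ->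
  u \in U -> v \in U -> u != v ->
  let D1 := wmatch Y s U * wmatch Y s (U :\ u :\ v) in
  let D2 := wmatch Y s (U :\ u) * wmatch Y s (U :\ v) in
  if col u == col v then D1 <= D2 else D2 <= D1.
Proof.
move=> Y0; have [n] := ubnP #|U|; elim: n U u v => // n IH U u v Un uU vU uv /=.
have Zge0 A : 0 <= wmatch Y s A by rewrite ltW // wmatch_gt0.
have uUv : u \in U :\ v by rewrite !inE uv.
have vUu : v \in U :\ u by rewrite !inE eq_sym uv.
have Un' : (#|U :\ u| < n)%N by move: Un; rewrite (cardsD1 u U) uU.
rewrite (wmatch_expand Y s Hl uU) (wmatch_expand Y s Hl uUv) (setD1AC U v u).
rewrite mulrDl mulrDr.
rewrite [X in if _ then X + _ <= _ else _]mulrAC [X in if _ then _ else _ <= X + _]mulrAC.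
rewrite ![wmatch Y s (U :\ u) * (Y u * _)]mulrC !lerD2l.
have step e : incident ends u e -> opposite u e \in U -> opposite u e != v ->
  let D1 := wmatch Y s (U :\ u :\ opposite u e) * wmatch Y s (U :\ u :\ v) in
  let D2 := wmatch Y s (U :\ u) * wmatch Y s (U :\ u :\ v :\ opposite u e) in
  if col u == col v then D1 <= D2 else D2 <= D1.
  move=> ue wU wv; have := IH _ (opposite u e) v Un' _ vUu wv.
  rewrite !inE opposite_neq // wU => /(_ isT) /=.
  rewrite (col_opposite ue) (setD1AC _ v (opposite u e)).
  by case: (col u) (col v) => -[].
rewrite mulr_suml mulr_sumr big_mkcond [X in if _ then _ <= X else _]big_mkcond [X in if _ then _ else X <= _]big_mkcond.
rewrite [X in if _ then _ else _ <= X]big_mkcond /=.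
(* An edge from [u] to [v] contributes only to the expansion in [D1]. With equal colours there is no
   such edge, and with different colours it adds to the larger side. *)
case: ifP => uvc; apply: ler_sum => e _; rewrite !inE.
  case ue: (incident ends u e) => //=; case wU: (_ \in U); last by rewrite andbF.
  case: (eqVneq (opposite u e) v) => [wv|wv] /=.
    by have := col_opposite ue; rewrite wv -(eqP uvc); case: (col u).
  rewrite -mulrA [X in _ <= X]mulrCA ler_wpM2l ?(ltW (lam_gt0 _)) //.
  by have := step e ue wU wv; rewrite uvc.
case ue: (incident ends u e) => //=; case wU: (_ \in U); last by rewrite andbF.
case: (eqVneq (opposite u e) v) => [wv|wv] /=.
  by rewrite !mulr_ge0 // ltW.
rewrite -mulrA [X in X <= _]mulrCA ler_wpM2l ?(ltW (lam_gt0 _)) //.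
by have := step e ue wU wv; rewrite uvc.
Qed.

End WeightedMatchings.

(** * The Bethe bound for bipartite graphs *)

Section Gibbs.
Variable R : realType.

Lemma ln_le_subr1 (x : R) : 0 < x -> ln x <= x - 1.
Proof. by move=> x0; have := @le_ln1Dx R (x - 1); rewrite (addrC 1) subrK; apply; lra. Qed.

Lemma gibbs (I : finType) (Q : pred I) (w s : I -> R) (w0 s0 : R) :
  0 < w0 -> 0 < s0 -> (forall i, 0 < w i) -> (forall i, 0 < s i) ->
  w0 + \sum_(i | Q i) w i = 1 ->
  w0 * (ln s0 - ln w0) + \sum_(i | Q i) w i * (ln (s i) - ln (w i))
    <= ln (s0 + \sum_(i | Q i) s i).
Proof.
move=> w00 s00 wgt0 sgt0 w1; set S := s0 + _.
have S0 : 0 < S by rewrite ltr_wpDr // sumr_ge0 // => i _; apply: ltW.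
have H (v t : R) : 0 < v -> 0 < t -> v * (ln t - ln v) <= v * ln S + t / S - v.
  move=> v0 t0; have tvS : 0 < t / (v * S) by rewrite divr_gt0 // mulr_gt0.
  have := ln_le_subr1 tvS.
  rewrite ln_div ?posrE ?mulr_gt0 // lnM ?posrE // => /(ler_wpM2l (ltW v0)).
  have -> : v * (t / (v * S) - 1) = t / S - v.
    by field; rewrite !gt_eqF.
  lra.
have -> : ln S = w0 * ln S + s0 / S - w0 + \sum_(i | Q i) (w i * ln S + s i / S - w i).
  rewrite sumrB big_split /= -mulr_suml -mulr_suml.
  have -> : \sum_(i | Q i) w i = 1 - w0 by lra.
  have -> : \sum_(i | Q i) s i = S - s0 by rewrite /S; ring.
  by field; rewrite gt_eqF.
by rewrite lerD ?H // ler_sum // => i _; apply: H.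
Qed.

(* The hypothesis is used at [e^p = al c / ((1 - al) d)] and [e^q = al a / ((1 - al) c)],
   the minimiser of [rhs / e^(al (p + q))] when [b c = a d]. *)
Lemma two_var_capacity (al a b c d l C : R) :
  0 < al < 1 -> 0 < a -> 0 < b -> 0 < c -> 0 < d -> 0 < l -> b * c <= a * d ->
  (forall p q : R, expR (C + al * (p + q)) <=
     a + expR p * b + expR q * (c + expR p * d)) ->
  expR (C + (al * ln l + xlnx al + xlnx (1 - al))) <= a + l * d.
Proof.
move=> /andP[al0 al1] a0 b0 c0 d0 l0 bcad H.
have al1' : 0 < 1 - al by lra.
have ald0 : 0 < al / (1 - al) by rewrite divr_gt0.
have := H (ln (al / (1 - al) * c / d)) (ln (al / (1 - al) * a / c)).
rewrite !lnK ?posrE ?divr_gt0 ?mulr_gt0 ?invr_gt0 //.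
rewrite !(ln_div, lnM) ?posrE ?divr_gt0 ?mulr_gt0 ?invr_gt0 // => H1.
(* With [rho = al / (1 - al)] the four terms become [a], at most [rho a] (by [b c <= a d]), [rho a]
   and [rho^2 a], hence at most [a (1 + rho)^2 = a / (1 - al)^2]. *)
have {H H1}H : C + al * (2 * (ln al - ln (1 - al)) + ln a - ln d) <= ln a - 2 * ln (1 - al).
  rewrite -ler_expR; apply: (@le_trans _ _ (a / (1 - al) ^+ 2)); last first.
    by rewrite expRB lnK ?posrE // mulr_natl mulr2n expRD lnK ?posrE // expr2.
  have -> : C + al * (2 * (ln al - ln (1 - al)) + ln a - ln d) = C + al *
    (ln al - ln (1 - al) + ln c - ln d + (ln al - ln (1 - al) + ln a - ln c)) by ring.
  apply: le_trans H1 _.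
  have -> : a / (1 - al) ^+ 2 = a + al / (1 - al) * a + al / (1 - al) * a / c * (c + al / (1 - al) * c / d * d).
    by field; rewrite !gt_eqF.
  rewrite lerD2r lerD2l -!mulrA ler_pM2l // ler_pM2l ?invr_gt0 //.
  by rewrite mulrCA mulrC ler_pdivrMr // mulrC.
(* Gibbs for the law [(1 - al, al)] on the edge being absent or present. One copy of the entropy of
   [al] cancels against the two copies in [H]. *)
have := @gibbs _ xpredT (fun _ : 'I_1 => al) (fun _ : 'I_1 => l * d) (1 - al) a.
rewrite !big_ord1 => /(_ al1' a0 (fun=> al0)).
rewrite mulr_gt0 // subrK => /(_ (fun=> isT) erefl) G.
have S0 : 0 < a + l * d by rewrite addr_gt0 // mulr_gt0.
rewrite -[leRHS]lnK ?posrE // ler_expR; apply: le_trans G.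
by rewrite lnM ?posrE // /xlnx !gt_eqF //; lra.
Qed.
End Gibbs.

Lemma sum_incident (R : realType) (V E : finType) (ends : E -> V * V)
    (F : V -> E -> R) : loopless ends ->
  \sum_v \sum_(e | incident ends v e) F v e
    = \sum_e (F (ends e).1 e + F (ends e).2 e).
Proof.
move=> Hl; rewrite (exchange_big_dep xpredT) //=; apply: eq_bigr => e _.
rewrite (bigD1 (ends e).1) ?/incident ?eqxx //= (bigD1 (ends e).2) /=; last first.
  by rewrite eqxx orbT eq_sym Hl.
by rewrite big1 ?addr0 // => v /andP[/andP[/orP[]/eqP ->]]; rewrite eqxx.
Qed.

Section BipartiteBethe.
Variables (R : realType) (V E : finType) (ends : E -> V * V).
Variables (lam : E -> R) (x : E -> R) (col : V -> bool).
Hypothesis lam_gt0 : forall e, 0 < lam e.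
Hypothesis Hcol : forall e, col (ends e).1 != col (ends e).2.
Hypothesis x_gt0 : forall e, 0 < x e.
Hypothesis x_lt1 : forall v, vsum ends x v < 1.

Local Notation a e := (ends e).1.
Local Notation b e := (ends e).2.

Let Hl : loopless ends.
Proof. by move=> e; apply: contra (Hcol e) => /eqP ->. Qed.

Let xe_lt1 e : x e < 1.
Proof.
apply: le_lt_trans (x_lt1 (a e)); rewrite /vsum (bigD1 e) ?/incident ?eqxx //=.
by rewrite lerDl sumr_ge0 // => f _; apply: ltW.
Qed.

Let Y (p : V -> E -> R) (s : seq E) (v : V) : R :=
  1 + \sum_(e | incident ends v e && (e \notin s)) expR (p v e).

(** The vertex terms hold [- xlnx (x e)] once for each end of [e]; inserting [e] gives back
    [xlnx (x e) + xlnx (1 - x e)]. Once all edges are inserted, what remains is [bethe]. *)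
Let K (s : seq E) : R :=
  \sum_(e <- s) (x e * ln (lam e) + xlnx (x e) + xlnx (1 - x e))
  + \sum_v (- (\sum_(e | incident ends v e) xlnx (x e)) - xlnx (1 - vsum ends x v)).

(* [expR (p v f)] is the weight that an edge [f] outside [s] contributes to its end [v];
   inserting [f] trades the two weights at its ends for the edge itself. *)
Lemma capacity_step (s : seq E) : uniq s -> forall p : V -> E -> R,
  expR (K s + \sum_(e | e \notin s) (x e * p (a e) e + x e * p (b e) e))
    <= wmatch ends lam (Y p s) s [set: V]%SET.
Proof.
elim: s => [_ p|e s IH /= /andP[es us] p].
  rewrite /= /K big_nil add0r.
  rewrite -[X in _ + X](sum_incident (fun v e => x e * p v e) Hl).
  rewrite [leRHS](eq_bigl xpredT) => [|v]; last by rewrite inE.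
  rewrite -big_split /= expR_sum; apply: ler_prod => v _.
  rewrite expR_ge0 /= -[leRHS]lnK; last first.
    by rewrite posrE ltr_wpDr // sumr_ge0 // => e _; apply: expR_ge0.
  rewrite ler_expR /Y.
  rewrite [in leRHS](eq_bigl (incident ends v)); last by move=> e; rewrite andbT.
  have xv0 : 0 < 1 - vsum ends x v by rewrite subr_gt0.
  (* Without edges the vertices are independent, and each factor is Gibbs for the law that picks the
     edge [e] at [v] with probability [x e] and leaves [v] uncovered otherwise. *)
  have := @gibbs R E (incident ends v) x (fun e => expR (p v e)) (1 - vsum ends x v) 1.
  move=> /(_ xv0 ltr01 x_gt0 (fun=> expR_gt0 _)); rewrite subrK => /(_ erefl).
  apply: le_trans; rewrite ln1 sub0r /xlnx gt_eqF //.
  rewrite [X in _ <= _ + X](eq_bigr (fun e => x e * p v e - x e * ln (x e))); last first.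
    by move=> e _; rewrite expRK mulrBr.
  rewrite sumrB [X in - X - _](eq_bigr (fun e => x e * ln (x e))); first by lra.
  by move=> e _; rewrite gt_eqF.
set Z := wmatch ends lam (Y p (e :: s)) s.
have Y0 v : 0 < Y p (e :: s) v.
  by rewrite /Y ltr_wpDr // sumr_ge0 // => f _; apply: expR_ge0.
have Z0 U : 0 < Z U by apply: wmatch_gt0.
have abT : a e \in [set: V]%SET /\ b e \in [set: V]%SET by rewrite !inE.
case: (abT) => aT bT.
have ray : Z ([set: V]%SET :\ a e) * Z ([set: V]%SET :\ b e) <= Z [set: V]%SET * Z ([set: V]%SET :\ a e :\ b e).
  have := wmatch_rayleigh lam_gt0 Hl Hcol s Y0 aT bT (Hl e).
  by rewrite (negPf (Hcol e)).
rewrite !inE /=.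
have -> : K (e :: s) + \sum_(f | f \notin e :: s) (x f * p (a f) f + x f * p (b f) f) =
  (K s + \sum_(f | f \notin e :: s) (x f * p (a f) f + x f * p (b f) f))
  + (x e * ln (lam e) + xlnx (x e) + xlnx (1 - x e)).
  by rewrite /K big_cons; ring.
apply: (@two_var_capacity R (x e) (Z [set: V]%SET) (Z ([set: V]%SET :\ a e))
  (Z ([set: V]%SET :\ b e)) (Z ([set: V]%SET :\ a e :\ b e))) => //.
  by rewrite x_gt0 xe_lt1.
move=> p0 q0.
(* Cutting [e] open lets its two half-edges carry arbitrary weights. The induction hypothesis at all
   of them is the premise of [two_var_capacity], which is why [p] is quantified inside the
   induction. *)
pose p' v f := if f == e then (if v == a e then p0 else q0) else p v f.
have := IH us p'.
rewrite (bigD1 e es) /= {1 2}/p' !eqxx [b e == a e]eq_sym (negPf (Hl e)).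
set S1 := \sum_(f | _ && _) _; set S2 := \sum_(f | _) _.
have -> : S1 = S2.
  rewrite /S1 /S2; apply: eq_big => f; first by rewrite !inE negb_or andbC.
  by rewrite /p' => /andP[_ /negPf ->].
rewrite -mulrDr [x e * _ + S2]addrC addrA; move=> H; apply: le_trans H _.
have -> : wmatch ends lam (Y p' s) s [set: V]%SET = wmatch ends lam (fun v => (Y p (e :: s) v +
   (v == a e)%:R * expR p0) + (v == b e)%:R * expR q0) s [set: V]%SET.
  apply: eq_wmatch => v _; rewrite /Y.
  have split_e f : f \notin e :: s = (f \notin s) && (f != e) by rewrite !inE negb_or andbC.
  case ve: (incident ends v e); last first.
    have [/negPf -> /negPf ->] : v != a e /\ v != b e.
      by move: ve => /negbT; rewrite negb_or ![_ == v]eq_sym => /andP.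
    rewrite !mul0r !addr0; congr (_ + _); apply: eq_big => f.
      rewrite split_e; case: eqP => [->|_]; last by rewrite andbT.
      by rewrite ve.
    by move=> /andP[vf _]; rewrite /p'; case: eqP => // fe; rewrite fe ve in vf.
  rewrite (bigD1 e) ?ve //= -!addrA; congr (_ + _); rewrite addrC; congr (_ + _).
    apply: eq_big => f; first by rewrite split_e andbA.
    by rewrite /p' => /andP[_ /negPf ->].
  rewrite /p' eqxx; move: ve; rewrite /incident; case: (eqVneq v (a e)) => [-> _|va].
    by rewrite (negPf (Hl e)) mul1r mul0r addr0.
  by rewrite /= eq_sym => ->; rewrite mul1r mul0r add0r.
rewrite wmatch_addw // wmatch_addw // wmatch_addw ?inE ?Hl //.
rewrite -/Z (setD1AC _ (b e)); exact: lexx.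
Qed.

Lemma bethe_le_wmatch :
  expR (\sum_e x e * ln (lam e) + bethe ends x)
    <= wmatch ends lam (fun=> 1) (index_enum E) [set: V]%SET.
Proof.
have := capacity_step (index_enum_uniq E) (fun _ _ => 0).
rewrite big_pred0 => [|e]; last by rewrite mem_index_enum.
rewrite (@eq_wmatch _ _ _ _ _ _ (fun=> 1)) => [|v _]; last first.
  by rewrite /Y big_pred0 ?addr0 // => e; rewrite mem_index_enum andbF.
apply: le_trans; rewrite ler_expR addr0 /K /bethe.
have /= sI := sum_incident (fun=> fun e => xlnx (x e)) Hl.
by rewrite !big_split /= !sumrN sI !big_split /=; lra.
Qed.
End BipartiteBethe.

(** * Weighted counts as sums over matchings *)

Section Matchings.
Variables (V E : finType) (ends : E -> V * V).
Local Notation a e := (ends e).1.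
Local Notation b e := (ends e).2.

Lemma is_matchingP (M : {set E}) :
  reflect (forall e f v, e \in M -> f \in M -> incident ends v e -> incident ends v f -> e = f)
          (is_matching ends M).
Proof.
apply: (iffP idP) => [/forallP H e f v eM fM ve vf|H].
  have /implyP/(_ eM)/forallP/(_ f)/implyP/(_ fM)/implyP := H e.
  by case: eqP => // _ /(_ isT)/forallP/(_ v); rewrite ve vf.
apply/forallP => e; apply/implyP => eM; apply/forallP => f; apply/implyP => fM.
apply/implyP => ef; apply/forallP => v; apply/negP => /andP[ve vf].
by move: ef; rewrite (H e f v) ?eqxx.
Qed.

Lemma sub_matching (M N : {set E}) : M \subset N -> is_matching ends N -> is_matching ends M.
Proof.
move=> /fintype.subsetP MN /is_matchingP H; apply/is_matchingP => e f v eM fM.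
by apply: H; apply: MN.
Qed.

Lemma is_matching0 : is_matching ends finset.set0.
Proof. by apply/is_matchingP => e f v; rewrite finset.in_set0. Qed.

Definition ends_in (U : {set V}) (M : {set E}) :=
  [forall e in M, (a e \in U) && (b e \in U)].

Lemma is_matching_setU1 (U : {set V}) (M : {set E}) e : e \notin M ->
  is_matching ends (e |: M) && ends_in U (e |: M) =
  [&& (a e \in U) && (b e \in U), is_matching ends M & ends_in (U :\ a e :\ b e) M].
Proof.
move=> eM; apply/andP/and3P => [[/is_matchingP mM /forall_inP inU]|[/andP[aU bU] /is_matchingP mM /forall_inP inU]].
  split; first by apply: inU; rewrite setU11.
    by apply/is_matchingP => f g v fM gM; apply: mM; rewrite inE ?fM ?gM orbT.
  apply/forall_inP => f fM; have fe : f != e by apply: contraNneq eM => <-.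
  have /andP[fa fb] := inU f (setU1r _ fM).
  have nv v : incident ends v e -> ~~ incident ends v f.
    move=> ve; apply/negP => vf; move: fe.
    by rewrite (mM f e v) ?eqxx ?setU11 ?setU1r.
  have := nv (a e); have := nv (b e); rewrite /incident !eqxx orbT !negb_or.
  move=> /(_ isT)/andP[? ?] /(_ isT)/andP[? ?].
  by rewrite !inE fa fb; apply/andP; split; apply/and3P.
split.
  apply/is_matchingP => f g v; rewrite !inE => /orP[/eqP ->|fM] /orP[/eqP ->|gM] //.
  - move=> ve vg; have := inU g gM; rewrite !inE.
    move: ve vg; rewrite /incident => /orP[]/eqP -> /orP[]/eqP ->;
    by rewrite !eqxx !(andbF, andFb).
  - move=> vg ve; have := inU f fM; rewrite !inE.
    move: ve vg; rewrite /incident => /orP[]/eqP -> /orP[]/eqP ->;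
    by rewrite !eqxx !(andbF, andFb).
  - exact: mM.
apply/forall_inP => f; rewrite !inE => /orP[/eqP ->|fM]; first by rewrite aU.
by have := inU f fM; rewrite !inE => /andP[/and3P[_ _ ->] /and3P[_ _ ->]].
Qed.

Lemma wmatch_sum (R : realType) (lam : E -> R) (s : seq E) (U : {set V}) : uniq s ->
  wmatch ends lam (fun=> 1) s U =
  \sum_(M : {set E} | (M \subset [set x in s]) && (is_matching ends M && ends_in U M))
     \prod_(e in M) lam e.
Proof.
elim: s U => [U _|e s IH U] /=.
  rewrite (bigD1 finset.set0) /=; last first.
    by rewrite finset.sub0set is_matching0; apply/forall_inP => e; rewrite finset.in_set0.
  rewrite [LHS]big1 // big_set0 big1 ?addr0 // => M /andP[/andP[+ _]].
  have -> : [set x in [::]] = finset.set0 :> {set E} by apply/setP => i; rewrite !inE.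
  by rewrite finset.subset0 => /eqP ->; rewrite eqxx.
move=> /andP[es us]; rewrite !IH // [RHS](bigID (fun M : {set E} => e \in M)) /= addrC; congr (_ + _).
  apply: eq_bigl => M; case eM: (e \in M).
    rewrite !andbF; apply/negbTE/negP => /andP[/fintype.subsetP /(_ e eM)].
    by rewrite inE (negPf es).
  rewrite andbT; congr (_ && _); apply/fintype.subsetP/fintype.subsetP => H i iM.
    by have := H i iM; rewrite !inE => ->; rewrite orbT.
  have := H i iM; rewrite !inE => /orP[/eqP ie|//]; by rewrite -ie iM in eM.
rewrite [RHS](reindex_onto (fun M => e |: M) (fun M => M :\ e)) /=; last first.
  by move=> M /andP[_ eM]; rewrite finset.setD1K.
case: ifPn => abU; last first.
  rewrite big_pred0 // => M; apply/negP => /andP[/andP[/andP[_ H] _] /eqP eM].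
  have eM' : e \notin M by rewrite -eM !inE eqxx.
  by move: H; rewrite is_matching_setU1 // (negPf abU).
rewrite mulr_sumr; apply: eq_big => [M|M].
  have [eM|eM] := boolP (e \in M).
    have -> : (M \subset [set x in s]) = false.
      by apply/negbTE/negP => /fintype.subsetP /(_ e eM); rewrite inE (negPf es).
    rewrite /=; apply/esym/negbTE/negP => /andP[_ /eqP H].
    by move: eM; rewrite -H !inE eqxx.
  rewrite is_matching_setU1 // abU setU11 andbT /= finset.setU1K // eqxx andbT; congr (_ && _).
  apply/fintype.subsetP/fintype.subsetP => H i.
    by rewrite !inE => /orP[->//|/H]; rewrite !inE => ->; rewrite orbT.
  move=> iM; have := H i; rewrite !inE iM orbT => /(_ isT) /orP[/eqP ie|//].
  by rewrite -ie iM in eM.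
case/andP => /fintype.subsetP Ms _; rewrite big_setU1 //=.
by apply/negP => /Ms; rewrite inE (negPf es).
Qed.

Lemma wmatch_full (R : realType) (lam : E -> R) :
  wmatch ends lam (fun=> 1) (index_enum E) [set: V]%SET =
  \sum_(M : {set E} | is_matching ends M) \prod_(e in M) lam e.
Proof.
rewrite wmatch_sum ?index_enum_uniq //; apply: eq_bigl => M.
have -> : ends_in [set: V]%SET M by apply/forall_inP => e _; rewrite !inE.
rewrite andbT; case: is_matching; rewrite ?andbF // andbT.
by apply/fintype.subsetP => e _; rewrite inE mem_index_enum.
Qed.
End Matchings.

(** * Continuity of the Bethe entropy *)

Section Continuity.
Variable R : realType.

Lemma xlnx_itv (t : R) : 0 <= t <= 1 -> -1 <= xlnx t <= 0.
Proof.
move=> /andP[t0 t1]; rewrite /xlnx; case: eqP => [_|/eqP tn]; first by lra.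
have tp : 0 < t by rewrite lt_def tn.
have l0 := ln_le0 t1.
apply/andP; split; last by rewrite mulr_ge0_le0.
have := @ln_le_subr1 R t^-1; rewrite invr_gt0 lnV ?posrE // => /(_ tp) H.
have : t * (1 - t^-1) <= t * ln t by rewrite ler_pM2l //; lra.
by apply: le_trans; rewrite mulrBr mulfV //; lra.
Qed.

(** Continuity holds on the whole line because [ln] is 0 at negative arguments, so that [xlnx]
    vanishes there; limits then need no domain condition. *)
Lemma xlnx_continuous : continuous (@xlnx R).
Proof.
move=> t; rewrite /continuous_at; case: (ltgtP t 0) => [t0|t0|->].
- have -> : xlnx t = 0 by rewrite /xlnx lt_eqF // ln0 ?mulr0 // ltW.
  apply: cvg_near_cst; near=> h.
  have h0 : h < 0 by near: h; exact: lt_nbhsl.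
  by rewrite /xlnx lt_eqF // ln0 ?mulr0 // ltW.
- have -> : xlnx t = t * ln t by rewrite /xlnx gt_eqF.
  have : (fun h => h * ln h) h @[h --> t] --> t * ln t.
    by apply: cvgM; [exact: cvg_id|exact: continuous_ln].
  apply: cvg_trans; apply: near_eq_cvg; near=> h.
  have h0 : 0 < h by near: h; exact: lt_nbhsr.
  by rewrite /xlnx gt_eqF.
- have -> : xlnx (0 : R) = 0 by rewrite /xlnx eqxx.
  (* With [r = sqrt h], [h ln h = 2 r^2 ln r], and [ln r >= 1 - 1/r] gives at least
     [2 r^2 - 2 r]. *)
  apply: (@squeeze_cvgr _ _ _ _ (fun h => - (2 * Num.sqrt h)) (fun=> 0)).
  + near=> h.
    have h1 : h <= 1 by apply: ltW; near: h; apply: lt_nbhsl; exact: ltr01.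
    have s0 := sqrtr_ge0 h.
    rewrite /xlnx; case: (ltgtP h 0) => [h0|h0|_]; last by lra.
      by rewrite ln0 ?mulr0 ?(ltW h0) //; lra.
    have l0 := ln_le0 h1.
    have r0 : 0 < Num.sqrt h by rewrite sqrtr_gt0.
    apply/andP; split; last by rewrite mulr_ge0_le0 // ltW.
    rewrite -[in leRHS](sqr_sqrtr (ltW h0)); set r := Num.sqrt h in r0 *.
    rewrite lnXn // -[ln r *+ 2]mulr_natl.
    have := @ln_le_subr1 R r^-1; rewrite invr_gt0 lnV ?posrE // => /(_ r0) H.
    have : r ^+ 2 * (2 * (1 - r^-1)) <= r ^+ 2 * (2 * ln r).
      by rewrite ler_pM2l ?exprn_gt0 // ler_pM2l //; lra.
    apply: le_trans.
    have -> : r ^+ 2 * (2 * (1 - r^-1)) = 2 * r ^+ 2 - 2 * r by field; rewrite gt_eqF.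
    by rewrite lerDr mulr_ge0 // sqr_ge0.
  + have H : Num.sqrt h @[h --> (0 : R)] --> (0 : R).
      by have := @sqrt_continuous R 0; rewrite /continuous_at sqrtr0.
    have H2 : (fun=> 2 : R) h @[h --> (0 : R)] --> (2 : R) by exact: cvg_cst.
    have := cvgN (cvgM H2 H); rewrite mulr0 oppr0; apply.
  + exact: cvg_cst.
Unshelve. all: by end_near. Qed.

Lemma cvg_sumr (T I : Type) (F : set_system T) (FF : Filter F) (r : seq I) (Q : pred I)
    (f : I -> T -> R) (l : I -> R) :
  (forall i, Q i -> f i t @[t --> F] --> l i) ->
  \sum_(i <- r | Q i) f i t @[t --> F] --> \sum_(i <- r | Q i) l i.
Proof. by move=> fl; apply: cvg_big => //; exact: add_continuous. Qed.

Variables (V E : finType) (ends : E -> V * V).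

Lemma cvg_xlnx (T : Type) (F : set_system T) (FF : Filter F) (f : T -> R) (l : R) :
  f @ F --> l -> xlnx (f t) @[t --> F] --> xlnx l.
Proof. by move=> fl; apply: (cvg_comp _ _ fl); exact: xlnx_continuous. Qed.

Lemma cvg_vsum (T : Type) (F : set_system T) (FF : Filter F) (f : T -> E -> R) (x : E -> R) v :
  (forall e, f t e @[t --> F] --> x e) ->
  vsum ends (f t) v @[t --> F] --> vsum ends x v.
Proof. by move=> fx; apply: cvg_sumr => e _; apply: fx. Qed.

Lemma cvg_edge_sum (T : Type) (F : set_system T) (FF : Filter F) (f : T -> E -> R) (x : E -> R) :
  (forall e, f t e @[t --> F] --> x e) ->
  edge_sum (f t) @[t --> F] --> edge_sum x.
Proof. by move=> fx; apply: cvg_sumr => e _; apply: fx. Qed.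

Lemma cvg_bethe (T : Type) (F : set_system T) (FF : Filter F) (f : T -> E -> R) (x : E -> R) :
  (forall e, f t e @[t --> F] --> x e) ->
  bethe ends (f t) @[t --> F] --> bethe ends x.
Proof.
move=> fx; apply: cvgB; apply: cvg_sumr => i _.
  apply: cvgD; first by apply: cvgN; apply: cvg_xlnx; exact: fx.
  by apply: cvg_xlnx; apply: cvgB; [exact: cvg_cst|exact: fx].
by apply: cvg_xlnx; apply: cvgB; [exact: cvg_cst|exact: cvg_vsum].
Qed.
End Continuity.

(** * The Bethe bound on the whole fractional matching polytope *)

Section BetheLower.
Variables (R : realType) (V E : finType) (ends : E -> V * V).

Lemma le_vsum (x : E -> R) e v : (forall e, 0 <= x e) -> incident ends v e ->
  x e <= vsum ends x v.
Proof. by move=> x0 ve; rewrite /vsum (bigD1 e ve) lerDl sumr_ge0. Qed.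

Lemma FM_le1 (x : E -> R) e : FM ends x -> 0 <= x e <= 1.
Proof.
move=> [x0 x1]; rewrite x0 (le_trans _ (x1 (ends e).1)) //.
by apply: le_vsum => //; rewrite /incident eqxx.
Qed.

Theorem bethe_lower (lam x : E -> R) :
  bipartite_graph ends -> (forall e, 0 < lam e) -> FM ends x ->
  expR (\sum_e x e * ln (lam e) + bethe ends x)
    <= \sum_(M : {set E} | is_matching ends M) \prod_(e in M) lam e.
Proof.
move=> [col Hcol] lam0 [x0 x1]; rewrite -wmatch_full; set C := wmatch _ _ _ _ _.
have C0 : 0 < C by apply: wmatch_gt0.
(* The point with all coordinates [u] is interior: positive, and with every vertex sum below 1. The
   sequence [y] approaches [x] along the segment from it, where the strict hypotheses of
   [bethe_le_wmatch] hold. *)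
pose u : R := (2 * (#|E|%:R + 1))^-1.
have n0 : 0 <= #|E|%:R :> R by rewrite ler0n.
have u0 : 0 < u by rewrite invr_gt0; lra.
have u1 : #|E|%:R * u < 1 by rewrite /u ltr_pdivrMr; lra.
pose y (n : nat) e := (1 - harmonic n) * x e + harmonic n * u.
have h01 n : 0 < (harmonic n : R) <= 1.
  by rewrite invr_gt0 ltr0n /= invf_le1 ?ltr0n // ler1n.
have yx e : y n e @[n --> \oo] --> x e.
  have hh : harmonic n @[n --> \oo] --> (0 : R) by exact: cvg_harmonic.
  have h1 : (1 - harmonic n) * x e @[n --> \oo] --> (1 - 0) * x e.
    by apply: cvgM; [apply: cvgB => //|]; exact: cvg_cst.
  have h2 : harmonic n * u @[n --> \oo] --> 0 * u.
    by apply: cvgM => //; exact: cvg_cst.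
  by have := cvgD h1 h2; rewrite subr0 mul1r mul0r addr0; apply.
have S n : \sum_e y n e * ln (lam e) + bethe ends (y n) <= ln C.
  rewrite -ler_expR (lnK C0); case/andP: (h01 n) => h0 h1.
  apply: (bethe_le_wmatch lam0 Hcol) => [e|v].
    by rewrite /y ltr_wpDl ?mulr_gt0 // mulr_ge0 // subr_ge0.
  rewrite /vsum /y big_split /= -!mulr_sumr.
  apply: (@le_lt_trans _ _ ((1 - harmonic n) * 1 + harmonic n * (#|E|%:R * u))); last first.
    by rewrite mulr1 -[ltRHS](subrK (harmonic n)) ltrD2l gtr_pMr.
  rewrite lerD // ?ler_wpM2l ?subr_ge0 //; first exact: x1.
  rewrite mulr_natl -sumr_const.
  by rewrite [leRHS](bigID (incident ends v)) /= lerDl sumr_ge0 // => *; apply: ltW.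
rewrite -[leRHS](lnK C0) ler_expR.
have cv : \sum_e y n e * ln (lam e) + bethe ends (y n) @[n --> \oo] -->
    \sum_e x e * ln (lam e) + bethe ends x.
  apply: cvgD; last exact: cvg_bethe.
  by apply: cvg_sumr => e _; apply: cvgM; [exact: yx|exact: cvg_cst].
have cC : (fun=> ln C) n @[n --> \oo] --> ln C by exact: cvg_cst.
by apply: (ler_cvg_to cv cC); exact: nearW.
Qed.

Lemma match_poly_sum (z : R) : match_poly ends z = \sum_(M : {set E} | is_matching ends M) z ^+ #|M|.
Proof.
rewrite /match_poly (partition_big (fun M : {set E} => inord #|M| : 'I_#|E|.+1) xpredT) //=.
apply: eq_bigr => k _; rewrite /nmatch -sum1_card natr_sum mulr_suml.
apply: eq_big => [M|M].
  rewrite inE; congr (_ && _); apply/eqP/eqP => [Mk|<-]; first by rewrite Mk inord_val.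
  by rewrite inordK // ltnS max_card.
by rewrite inE => /andP[_ /eqP ->]; rewrite mul1r.
Qed.

Lemma bethe_lower_poly (z : R) (x : E -> R) :
  bipartite_graph ends -> 0 < z -> FM ends x ->
  expR (edge_sum x * ln z + bethe ends x) <= match_poly ends z.
Proof.
move=> bip z0 xFM; rewrite match_poly_sum /edge_sum mulr_suml.
apply: le_trans (bethe_lower bip (fun=> z0) xFM) _.
by apply: ler_sum => M _; rewrite prodr_const.
Qed.
End BetheLower.

(** * The bipartite double cover *)

Lemma ler_sum_inj (R : realType) (I J : finType) (P : pred I) (Q : pred J) (h : I -> J)
    (G : J -> R) :
  {in P &, injective h} -> (forall i, P i -> Q (h i)) -> (forall j, 0 <= G j) ->
  \sum_(i | P i) G (h i) <= \sum_(j | Q j) G j.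
Proof.
move=> hinj hPQ G0.
rewrite [leLHS](eq_bigl (fun i => i \in [set i | P i]%SET)) => [|i]; last by rewrite inE.
rewrite -big_imset => [|i j]; last by rewrite !inE; apply: hinj.
rewrite [leRHS](bigID (fun j => j \in [set h i | i in [set i | P i]]%SET)) /=.
rewrite -[leLHS]addr0 lerD ?sumr_ge0 // le_eqVlt; apply/orP; left; apply/eqP.
apply: eq_bigl => j; apply/idP/andP => [jh|[]//]; split=> //.
by case/imsetP: jh => i; rewrite inE => Pi ->; apply: hPQ.
Qed.

Section DoubleCover.
Variables (W F : finType) (ends : F -> W * W).

(* [(e, o)] is the dart of [e] that is reversed with respect to [ends e] iff [o]. *)
Definition dsrc (d : F * bool) : W := if d.2 then (ends d.1).2 else (ends d.1).1.
Definition dtgt (d : F * bool) : W := if d.2 then (ends d.1).1 else (ends d.1).2.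

Definition double_cover (d : F * bool) : (W * bool) * (W * bool) :=
  ((dsrc d, false), (dtgt d, true)).

Definition two_copies (d : F * bool) : (W * bool) * (W * bool) :=
  (((ends d.1).1, d.2), ((ends d.1).2, d.2)).

Lemma double_cover_bipartite : bipartite_graph double_cover.
Proof. by exists snd. Qed.

(** A matching of the double cover is a partial permutation of [W] carried by darts: disjoint
    directed paths and cycles, a doubled edge being a cycle of length 2. *)
Lemma double_cover_matchingP (M : {set F * bool}) :
  reflect ({in M &, injective dsrc} /\ {in M &, injective dtgt})
          (is_matching double_cover M).
Proof.
apply: (iffP (is_matchingP _ _)) => [H|[Hs Ht] d d' [v o] dM dM'].
  split=> d d' dM dM' E.
    by apply: (H d d' (dsrc d, false)) => //; rewrite /incident /= ?E eqxx.
  by apply: (H d d' (dtgt d, true)) => //; rewrite /incident /= ?E eqxx orbT.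
rewrite /incident /= !xpair_eqE; case: o; rewrite ?(andbT, andbF) ?orbF ?orFb.
  by move=> /eqP vd /eqP vd'; apply: Ht => //; rewrite vd vd'.
by move=> /eqP vd /eqP vd'; apply: Hs => //; rewrite vd vd'.
Qed.

Lemma two_copies_matchingP (N : {set F * bool}) :
  reflect (forall e f o v, (e, o) \in N -> (f, o) \in N ->
             incident ends v e -> incident ends v f -> e = f)
          (is_matching two_copies N).
Proof.
apply: (iffP (is_matchingP _ _)) => [H e f o v eN fN ve vf|H [e o] [f o'] [v o'']].
  suff [] : (e, o) = (f, o) by [].
  apply: (H _ _ (v, o)) => //; rewrite /incident /= !xpair_eqE eqxx !andbT.
    exact: ve.
  exact: vf.
rewrite /incident /= !xpair_eqE -!andb_orl => eN fN /andP[ve /eqP ho] /andP[vf /eqP ho'].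
by subst o o'; rewrite (H e f o'' v).
Qed.

Lemma match_poly_two_copies (R : realType) (z : R) :
  match_poly two_copies z = match_poly ends z ^+ 2.
Proof.
rewrite !match_poly_sum expr2 big_distrlr /= pair_big /=.
pose f (N : {set F * bool}) := ([set e | (e, false) \in N], [set e | (e, true) \in N])%SET.
pose g (p : {set F} * {set F}) := [set d : F * bool | if d.2 then d.1 \in p.2 else d.1 \in p.1]%SET.
have fK : cancel f g by move=> N; apply/setP => -[e []]; rewrite !inE.
have gK : cancel g f by move=> [A B]; congr pair; apply/setP => e; rewrite !inE.
rewrite [RHS](reindex f) /=; last by exists g => ? _.
apply: eq_big => N.
  apply/two_copies_matchingP/andP => [H|[/is_matchingP H1 /is_matchingP H2] e f' [] v eN fN].
  - split; apply/is_matchingP => e f' v; rewrite !inE => eN fN; exact: H eN fN.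
  - by apply: H2; rewrite inE.
  - by apply: H1; rewrite inE.
move=> _; rewrite -exprD; congr (_ ^+ _).
have {1}-> : N = (pair^~ false @: (f N).1 :|: pair^~ true @: (f N).2)%SET.
  apply/setP => -[e o]; rewrite !inE; apply/idP/orP.
    by case: o => eN; [right|left]; apply/imsetP; exists e; rewrite ?inE.
  by case=> /imsetP[e']; rewrite inE => He [-> ->].
rewrite cardsU (_ : _ :&: _ = finset.set0)%SET ?cards0 ?subn0; last first.
  apply/setP => -[e o]; rewrite !inE; apply/negP => /andP[/imsetP[? _ [_ ->]] /imsetP[? _ []]].
  by [].
by rewrite !card_imset // => ? ? [].
Qed.

Hypothesis Hl : loopless ends.

(* Over a fixed shape, a matching of the double cover amounts to an orientation of the
   single edges, and a matching of two copies to a proper 2-colouring of them. *)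
Definition shape (M : {set F * bool}) : {set F} * {set F} :=
  ([set e | ((e, false) \in M) (+) ((e, true) \in M)],
   [set e | ((e, false) \in M) && ((e, true) \in M)])%SET.

Definition colourable (M : {set F * bool}) :=
  [exists N : {set F * bool}, is_matching two_copies N && (shape N == shape M)].

Lemma card_shape M M' : shape M = shape M' -> #|M| = #|M'|.
Proof.
have cM (N : {set F * bool}) : #|N| = (#|(shape N).1| + #|(shape N).2| * 2)%N.
  rewrite -!sum1_card big_mkcond /=.
  rewrite (eq_bigr (fun d => if (d.1, d.2) \in N then 1 else 0)%N) => [|[]//].
  rewrite -(pair_bigA _ (fun e o => if (e, o) \in N then 1 else 0)%N) /=.
  rewrite big_distrl /= [X in (X + _)%N]big_mkcond [X in (_ + X)%N]big_mkcond -big_split /=.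
  apply: eq_bigr => e _; rewrite big_bool /= !inE.
  by case: (_ \in N); case: (_ \in N).
by rewrite !cM => ->.
Qed.

(** Each dart goes to the copy named by its colour. Distinct darts of [M] meeting at a vertex are
    consecutive there, so they go to different copies; the two darts of a doubled edge follow each
    other, so that edge appears in both copies and the shape is kept. *)
Lemma colourable_col (M : {set F * bool}) (c : F * bool -> bool) :
  is_matching double_cover M ->
  (forall d d', d \in M -> d' \in M -> dtgt d = dsrc d' -> c d != c d') ->
  colourable M.
Proof.
move=> /double_cover_matchingP[Hs Ht] Hc.
have Hbool e : (e, false) \in M -> (e, true) \in M -> c (e, false) != c (e, true).
  by move=> ? ?; apply: Hc.
have Hinc d d' v : d \in M -> d' \in M -> incident ends v d.1 -> incident ends v d'.1 ->
    c d = c d' -> d = d'.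
  move=> dM dM' vd vd' E.
  have st d0 : incident ends v d0.1 -> v = dsrc d0 \/ v = dtgt d0.
    by rewrite /incident /dsrc /dtgt; case: d0.2 => /orP[] /eqP; auto.
  case: (st d vd) (st d' vd') => [e1|e1] [e2|e2].
  - by apply: Hs => //; rewrite -e1.
  - by have := Hc d' d dM' dM; rewrite E eqxx -e1 -e2 => /(_ erefl).
  - by have := Hc d d' dM dM'; rewrite E eqxx -e1 -e2 => /(_ erefl).
  - by apply: Ht => //; rewrite -e1.
pose N := [set p : F * bool | [exists o, ((p.1, o) \in M) && (c (p.1, o) == p.2)]]%SET.
apply/existsP; exists N; apply/andP; split.
  apply/two_copies_matchingP => e f o v; rewrite !inE => /existsP[ o1 /andP[eM /eqP ce]].
  move=> /existsP[ o2 /andP[fM /eqP cf]] ve vf.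
  by have [] : (e, o1) = (f, o2) by apply: (Hinc _ _ v) => //; rewrite ce cf.
have memN e k : ((e, k) \in N) = ((e, false) \in M) && (c (e, false) == k)
    || ((e, true) \in M) && (c (e, true) == k).
  rewrite inE; apply/existsP/orP => [[[] /= ?]|[]?]; [by right|by left|by exists false|by exists true].
clearbody N; apply/eqP; congr pair; apply/setP => e; move: (Hbool e); rewrite !inE !memN;
  case: (_ \in M); case: (_ \in M) => /= Hb;
  try (have := Hb isT isT); case: (c (e, false)); case: (c (e, true)) => //.
Qed.

Let base (P : pred {set F * bool}) t := odflt finset.set0 [pick M | P M && (shape M == t)].

Let baseP (P : pred {set F * bool}) M : P M -> P (base P (shape M)) /\ shape (base P (shape M)) = shape M.
Proof.
move=> PM; rewrite /base; case: pickP => [N /andP[? /eqP]//|/(_ M)].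
by rewrite PM eqxx.
Qed.

(* The orientations and the 2-colourings solve two F_2-affine systems with the same linear
   part, so a reference solution of each translates one kind into the other. *)
Let recolour (M : {set F * bool}) : {set F * bool} :=
  let t := shape M in
  [set d | (d.1 \in t.2) || (d.1 \in t.1) &&
    (d.2 == ((d.1, true) \in M) (+) ((d.1, true) \in base (is_matching double_cover) t)
         (+) ((d.1, true) \in base (is_matching two_copies) t))]%SET.

Let shape_recolour M : shape (recolour M) = shape M.
Proof.
rewrite [LHS]/shape [RHS]/shape; congr pair; apply/setP => e; rewrite !inE /=;
case: ((e, false) \in M); case: ((e, true) \in M) => //=; case: (_ \in base _ _); case: (_ \in base _ _) => //.
Qed.

(** A doubled edge occupies both the outgoing and the incoming place at each of its ends, so no
    other edge can meet it. *)
Let double_edge M e f v o : is_matching double_cover M -> e \in (shape M).2 ->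
  (f, o) \in M -> incident ends v e -> incident ends v f -> e = f.
Proof.
move=> /double_cover_matchingP[Hs Ht]; rewrite inE => /andP[e0 e1] fM ve vf.
have [k ks] : exists k, dsrc (e, k) = v.
  by case/orP: ve => /eqP <-; [exists false|exists true].
have [l lt] : exists l, dtgt (e, l) = v.
  by case/orP: ve => /eqP <-; [exists true|exists false].
have eM m : (e, m) \in M by case: m.
have [H|H] : dsrc (f, o) = v \/ dtgt (f, o) = v.
- by move: vf; rewrite /incident /dsrc /dtgt /=; case: (o) => /orP[] /eqP; auto.
- by have [] : (e, k) = (f, o) by apply: Hs => //; rewrite ks H.
- by have [] : (e, l) = (f, o) by apply: Ht => //; rewrite lt H.
Qed.

(** Of two single edges meeting at [v], one enters and the other leaves. The sum modulo 2 of their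
    orientation bits thus depends on [ends] and [v] alone: it is the right-hand side of the affine
    system. *)
Let single_edges M e f v : is_matching double_cover M ->
  e \in (shape M).1 -> f \in (shape M).1 -> incident ends v e -> incident ends v f -> e <> f ->
  ((e, true) \in M) (+) ((f, true) \in M) = ~~ (((ends e).2 == v) (+) ((ends f).2 == v)).
Proof.
move=> /double_cover_matchingP[Hs Ht] eS fS ve vf ef.
have side g : g \in (shape M).1 -> incident ends v g ->
    exists q, [/\ (g, q) \in M, ((g, true) \in M) = q &
      (if q == ((ends g).2 == v) then dsrc (g, q) else dtgt (g, q)) = v].
  rewrite inE /incident => gS vg; exists ((g, true) \in M).
  have := Hl g; move: gS vg; rewrite /dsrc /dtgt.
  case: (boolP ((g, true) \in M)) => [gM _|gM] /=.
    case: eqP => [-> //|n2]; case: eqP => // -> _ _; by split.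
  rewrite addbF => gM'; case: (eqVneq (ends g).2 v) => [-> //|n2].
  by rewrite orbF => /eqP ->.
have [q [eM -> eo]] := side e eS ve; have [p [fM -> fp]] := side f fS vf.
case: (eqVneq q ((ends e).2 == v)) eo eM => [-> /= eo eM|nq /= eo eM];
case: (eqVneq p ((ends f).2 == v)) fp fM => [-> /= fp fM|np /= fp fM].
- by case: ef; have [] := Hs _ _ eM fM (etrans eo (esym fp)).
- by move: np; case: (p); case: ((ends f).2 == v); case: ((ends e).2 == v).
- by move: nq; case: (q); case: ((ends f).2 == v); case: ((ends e).2 == v).
- by case: ef; have [] := Ht _ _ eM fM (etrans eo (esym fp)).
Qed.

Let recolour_matching M : is_matching double_cover M -> colourable M ->
  is_matching two_copies (recolour M).
Proof.
move=> mM /existsP[N /andP[mN /eqP sN]].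
have [mM0 sM0] := baseP (P := is_matching double_cover) mM.
have [] := baseP (P := is_matching two_copies) mN; rewrite sN => /two_copies_matchingP mN0 sN0.
set M0 := base _ _ in mM0 sM0; set N0 := base _ _ in mN0 sN0.
apply/two_copies_matchingP => e f k v; rewrite /recolour -/M0 -/N0 finset.in_set [in X in _ -> X]finset.in_set /=.
have inM g : (g \in (shape M).2) || (g \in (shape M).1) -> exists o, (g, o) \in M.
  rewrite !inE; case gt: ((g, true) \in M); first by exists true.
  by rewrite andbF addbF => /= gf; exists false.
case eD: (e \in (shape M).2) => /=.
  move=> _ fk ve vf; have [|o fM] := inM f; last exact: double_edge mM eD fM ve vf.
  by move: fk; case: (f \in (shape M).2) => //= /andP[].
case/andP => eS /eqP ke; case fD: (f \in (shape M).2) => /=.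
  move=> _ ve vf; have [|o eM] := inM e; first by rewrite eS orbT.
  by apply/esym; exact: double_edge mM fD eM vf ve.
case/andP => fS /eqP kf ve vf; apply: contrapT => ef.
have E1 := single_edges mM eS fS ve vf ef.
have E2 : ((e, true) \in M0) (+) ((f, true) \in M0) = ~~ (((ends e).2 == v) (+) ((ends f).2 == v)).
  by apply: single_edges; rewrite ?sM0.
have E3 : ((e, true) \in N0) != ((f, true) \in N0).
  apply: contra_notN ef => /eqP E.
  have inN g : g \in (shape M).1 -> (g, (g, true) \in N0) \in N0.
    by rewrite -sN0 inE; case gt: ((g, true) \in N0); rewrite ?addbF.
  by apply: (mN0 e f ((e, true) \in N0) v) => //; [exact: inN|rewrite E; exact: inN].
(* [M] and [M0] have the same right-hand side and cancel on the pair [e, f], while [N0] separates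
   the two edges. So they cannot both have landed in copy [k]. *)
move: ke kf E1 E2 E3 => ->.
case: ((e, true) \in M); case: ((f, true) \in M); case: (_ (+) (_ == v));
case: ((e, true) \in M0); case: ((f, true) \in M0);
case: ((e, true) \in N0); case: ((f, true) \in N0) => //.
Qed.

Let recolour_inj : injective recolour.
Proof.
move=> M M' E.
have sE : shape M = shape M' by rewrite -shape_recolour E shape_recolour.
have s1 e : (e \in (shape M).1) = (e \in (shape M').1) by rewrite sE.
have s2 e : (e \in (shape M).2) = (e \in (shape M').2) by rewrite sE.
apply/setP => -[e k].
have : ((e, true) \in recolour M) = ((e, true) \in recolour M') by rewrite E.
rewrite !inE /= sE; have := s1 e; have := s2 e; rewrite !inE.
set b1 := _ \in base _ _; set b2 := _ \in base _ _; case: b1; case: b2; case: k;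
case: ((e, false) \in M); case: ((e, true) \in M);
case: ((e, false) \in M'); case: ((e, true) \in M') => //.
Qed.

Lemma sum_colourable (R : realType) (z : R) : 0 < z ->
  \sum_(M : {set F * bool} | is_matching double_cover M && colourable M) z ^+ #|M|
    <= match_poly ends z ^+ 2.
Proof.
move=> z0; rewrite -match_poly_two_copies match_poly_sum.
rewrite (eq_bigr (fun M => z ^+ #|recolour M|)); last first.
  by move=> M _; rewrite (card_shape (shape_recolour M)).
apply: (@ler_sum_inj _ _ _ _ _ recolour (fun N : {set F * bool} => z ^+ #|N|)).
- by move=> M M' _ _; apply: recolour_inj.
- by move=> M /andP[mM cM]; apply: recolour_matching.
- by move=> N; rewrite exprn_ge0 // ltW.
Qed.

(** Matchings are grouped by the deleted set. Within a group [M] is recovered from [M :\: X], and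
    the deletion costs a factor [z ^+ #|X|]; the maximum with 1 covers sets smaller than [r] when
    [z > 1] and powers below 1 when [z < 1]. *)
Lemma double_cover_le (R : realType) (z : R) (r : nat) : 0 < z ->
  (forall M : {set F * bool}, is_matching double_cover M ->
     exists X : {set F * bool}, [/\ (#|X| <= r)%N, X \subset M & colourable (M :\: X)]) ->
  match_poly double_cover z <= #|[set X : {set F * bool} | (#|X| <= r)%N]%SET|%:R *
     Num.max 1 z ^+ r * match_poly ends z ^+ 2.
Proof.
move=> z0 H; rewrite [leLHS]match_poly_sum.
pose X (M : {set F * bool}) := odflt finset.set0
  [pick X : {set F * bool} | [&& (#|X| <= r)%N, X \subset M & colourable (M :\: X)]].
have XP M : is_matching double_cover M ->
    [/\ (#|X M| <= r)%N, X M \subset M & colourable (M :\: X M)].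
  move=> /H[X0 [X0r X0M cX]]; rewrite /X; case: pickP => [? /and3P[]//|/(_ X0)].
  by rewrite X0r X0M cX.
rewrite (partition_big X (fun X => (#|X| <= r)%N)) /=; last by move=> M /XP[].
rewrite -sum1_card natr_sum -!mulrA mulr_suml.
rewrite [leRHS](eq_bigl (fun X : {set F * bool} => (#|X| <= r)%N)); last by move=> ?; rewrite inE.
apply: ler_sum => Y Yr; rewrite mul1r.
apply: (@le_trans _ _ (Num.max 1 z ^+ r * \sum_(M : {set F * bool} |
    is_matching double_cover M && colourable M) z ^+ #|M|)); last first.
  by rewrite ler_wpM2l ?sum_colourable // exprn_ge0 // le_max ler01.
have m1 : 1 <= Num.max 1 z by rewrite le_max lexx.
have m0 : 0 <= Num.max 1 z by apply: le_trans m1.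
apply: (@le_trans _ _ (\sum_(M | is_matching double_cover M && (X M == Y))
    Num.max 1 z ^+ r * z ^+ #|M :\: Y|)).
  apply: ler_sum => M /andP[mM /eqP XY]; rewrite -(cardsID Y M) exprD.
  rewrite ler_wpM2r ?exprn_ge0 ?(ltW z0) //.
  apply: (@le_trans _ _ (Num.max 1 z ^+ #|M :&: Y|)).
    by rewrite lerXn2r ?nnegrE ?(ltW z0) // le_max lexx orbT.
  apply: ler_weXn2l => //; apply: leq_trans Yr; apply: subset_leq_card.
  exact: finset.subsetIr.
rewrite -mulr_sumr ler_wpM2l ?exprn_ge0 //.
apply: (@ler_sum_inj _ _ _ _ _ (fun M => M :\: Y) (fun N : {set F * bool} => z ^+ #|N|)).
- move=> M M' /andP[/XP[_ MY _] /eqP XY] /andP[/XP[_ MY' _] /eqP XY'] E.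
  rewrite -(finset.setID M Y) -(finset.setID M' Y) E; congr (_ :|: _).
  by move: MY MY'; rewrite XY XY' => /finset.setIidPr -> /finset.setIidPr ->.
- move=> M /andP[mM /eqP XY]; have [_ _] := XP _ mM; rewrite XY => ->; rewrite andbT.
  by apply: sub_matching mM; exact: finset.subsetDl.
- by move=> N; rewrite exprn_ge0 // ltW.
Qed.
End DoubleCover.

(** * Removing odd cycles *)

(** Completes a partial injection to a permutation, so that paths and cycles of darts can be handled
    as orbits. Each transposition corrects one image without disturbing the earlier ones. *)
Lemma perm_extend (D T : finType) (s t : D -> T) (l : seq D) : uniq l ->
  {in l &, injective s} -> {in l &, injective t} ->
  exists p : {perm T}, {in l, forall d, p (s d) = t d}.
Proof.
elim: l => [_ _ _|d l IH /= /andP[dl ul] Hs Ht]; first by exists 1%g.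
have sub : {subset l <= d :: l} by move=> x xl; rewrite inE xl orbT.
have [p pE] := IH ul (sub_in2 sub Hs) (sub_in2 sub Ht).
exists (p * tperm (p (s d)) (t d))%g => x; rewrite inE permM => /orP[/eqP ->|xl].
  by rewrite tpermL.
have xd : x != d by apply: contraNneq dl => <-.
rewrite (pE x xl) tpermD //.
  rewrite -(pE x xl); apply: contra xd => /eqP/perm_inj/esym E; apply/eqP.
  by apply: Hs => //; [exact: sub|rewrite inE eqxx].
rewrite eq_sym; apply: contra xd => /eqP E; apply/eqP; apply: Ht => //; last by rewrite inE eqxx.
exact: sub.
Qed.

Section OddCut.
Variables (W F : finType) (ends : F -> W * W).

(** Ordered pairs of vertex-disjoint rooted directed [m]-cycles. Pairs are counted because
    Borel-Cantelli needs a summable bound: having order [n] cycles means order [n^2] pairs, and a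
    bounded mean then gives probability [O(1/n^2)], whereas Markov on single cycles gives only
    [O(1/n)]. *)
Definition cycle_pairs (m : nat) : {set {ffun bool * 'I_m -> F * bool}} :=
  [set g : {ffun bool * 'I_m -> F * bool} | injectiveb (fun k => dsrc ends (g k)) &&
     [forall k, dtgt ends (g k) == dsrc ends (g (k.1, ordS k.2))]]%SET.

Variable M : {set F * bool}.
Hypothesis mM : is_matching (double_cover ends) M.

Let s := dsrc ends.
Let t := dtgt ends.

Variable p : {perm W}.
Hypothesis pM : {in M, forall d, p (s d) = t d}.

(* Rooting an orbit at a vertex without incoming dart, if there is one, makes the parity of
   the position along the orbit a proper colouring unless the orbit is an odd cycle of darts. *)
Let rt (u : W) : W :=
  if [pick w | fconnect p u w && (w \notin t @: M)] is Some w then w else froot p u.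

Let psym := fconnect_sym (@perm_inj _ p).

Let rt_connect u : fconnect p u (rt u).
Proof. by rewrite /rt; case: pickP => [w /andP[]//|_]; exact: connect_root. Qed.

Let rt_eq u v : fconnect p u v -> rt u = rt v.
Proof.
move=> uv; rewrite /rt; have e := same_connect psym uv.
rewrite (@eq_pick _ _ (fun w => fconnect p v w && (w \notin t @: M))) => [|w]; last by rewrite e.
by case: pickP => // _; apply/eqP; rewrite root_connect.
Qed.

Let idx u := findex p (rt u) u.

(** The darts that close an odd orbit at its root, one per odd cycle. *)
Let X := [set d in M | (t d == rt (s d)) && odd (fingraph.order p (t d))]%SET.

Let rt_p u : rt (p u) = rt u.
Proof. by apply/esym/rt_eq; exact: fconnect1. Qed.

Let X_colourable : colourable ends (M :\: X).
Proof.
apply: (@colourable_col _ _ _ _ (fun d => odd (idx (s d)))).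
  by apply: sub_matching mM; exact: finset.subsetDl.
move=> d d'; rewrite finset.in_setD => /andP[dX dM]; rewrite finset.in_setD => /andP[_ d'M].
rewrite -/t -/s => E; rewrite -E -(pM dM) /idx rt_p.
have cu : fconnect p (rt (s d)) (s d) by rewrite psym.
have := findex_max cu; set i := findex _ _ _; set r := rt (s d) => io.
have pu : p (s d) = iter i.+1 p r by rewrite iterS iter_findex.
rewrite pu; move: io; rewrite leq_eqVlt => /orP[/eqP io|io]; last first.
  by rewrite findex_iter //=; case: (odd i).
(* Back at the root, the position drops from the orbit size minus 1 to 0. The parities differ when
   the size is even, and for odd size [d] would lie in [X]. *)
have pr : p (s d) = r by rewrite pu io (iter_order (@perm_inj _ p)).
have tr : t d = r by rewrite -pM.
move: dX; rewrite inE dM -/r tr eqxx /= -io /= => /negbNE oi.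
by rewrite -[p (iter i p r)]/(iter i.+1 p r) -pu pr findex0 oi.
Qed.

Let roots := t @: X.

(** A root with an incoming dart was chosen only because every vertex of its orbit has one, so the
    whole orbit is a cycle of darts of [M]. *)
Let root_rt w : w \in roots -> [/\ rt w = w, odd (fingraph.order p w) &
  forall u, fconnect p w u -> exists2 d, d \in M & s d = u].
Proof.
case/imsetP => d; rewrite inE => /andP[dM /andP[/eqP tr od]] ->.
have rw : rt (t d) = t d by rewrite -(pM dM) rt_p -tr pM.
split=> // u wu.
have : p u \in t @: M.
  have : rt (t d) \in t @: M by rewrite rw imset_f.
  rewrite {1}/rt; case: pickP => [w1 /andP[_ /negPf ->]//|/(_ (p u)) + _].
  by rewrite (connect_trans wu (fconnect1 _ _)) /= => /negbFE.
case/imsetP => d' d'M pu; exists d' => //; apply: (@perm_inj _ p).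
by rewrite pM.
Qed.

Let roots_inj w w' : w \in roots -> w' \in roots -> fconnect p w w' -> w = w'.
Proof. by move=> /root_rt[ew _ _] /root_rt[ew' _ _] /rt_eq; rewrite ew ew'. Qed.

Let iter_inj w w' i j : w \in roots -> w' \in roots -> (i < fingraph.order p w)%N -> (j < fingraph.order p w')%N ->
  iter i p w = iter j p w' -> w = w' /\ i = j.
Proof.
move=> wr w'r iw jw E; have ww : w = w'.
  apply: roots_inj => //; apply: (connect_trans (fconnect_iter p i w)).
  by rewrite psym E fconnect_iter.
split=> //; rewrite -(findex_iter iw) -(findex_iter jw) E ww; congr findex.
Qed.

Let long_roots l : (#|[set w in roots | l <= fingraph.order p w]%SET| * l <= #|W|)%N.
Proof.
rewrite -[l in (_ * l)%N]card_ord -(cardsT (ordinal l)) -finset.cardsX.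
rewrite -(@card_in_imset _ _ (fun q : W * 'I_l => iter q.2 p q.1)) ?max_card //.
move=> [w i] [w' j]; rewrite !inE /= !andbT => /andP[wr wl] /andP[w'r w'l] E.
have [] := iter_inj wr w'r _ _ E.
- exact: leq_trans (ltn_ord i) wl.
- exact: leq_trans (ltn_ord j) w'l.
by move=> -> /ord_inj ->.
Qed.

Let Q m := [set w in roots | fingraph.order p w == m]%SET.

(** Distinct roots have disjoint orbits, so an ordered pair of distinct roots traces out a member of
    [cycle_pairs] and is read off its starting points. *)
Let Q_pairs m : (#|Q m| * #|Q m|.-1 <= #|cycle_pairs m|)%N.
Proof.
have [->|/set0Pn[w0]] := eqVneq (Q m) finset.set0; first by rewrite cards0.
rewrite inE => /andP[/root_rt[_ _ /(_ w0 (connect0 _ _))[d0 _ _]] /eqP].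
case: m => [|m' _]; first by move=> E; have := fingraph.order_gt0 p w0; rewrite E.
set m := m'.+1.
pose dart u := odflt d0 [pick d in M | s d == u].
have dartP w k : w \in roots -> s (dart (iter k p w)) = iter k p w /\ t (dart (iter k p w)) = iter k.+1 p w.
  move=> /root_rt[_ _ /(_ _ (fconnect_iter p k w))[d dM du]].
  rewrite /dart; case: pickP => [d' /= /andP[d'M /eqP sd]|/(_ d)]; last by rewrite dM du eqxx.
  by split=> //; rewrite -pM // sd.
pose h (ww : W * W) : {ffun bool * 'I_m -> F * bool} :=
  [ffun k : bool * 'I_m => dart (iter k.2 p (if k.1 then ww.1 else ww.2))].
pose P2 := [set ww in finset.setX (Q m) (Q m) | ww.1 != ww.2]%SET.
have cP2 : (#|Q m| * #|Q m|.-1 = #|P2|)%N.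
  have : (#|finset.setX (Q m) (Q m)| = #|P2| + #|Q m|)%N.
    rewrite -(cardsID [set ww : W * W | ww.1 != ww.2]%SET (finset.setX (Q m) (Q m))); congr (_ + _)%N.
      by apply: eq_card => ww; rewrite !inE.
    rewrite -(card_imset (Q m) (f := fun w => (w, w))); last by move=> ? ? [].
    apply: eq_card => -[w w']; rewrite !inE /= negbK; apply/andP/imsetP.
      by case=> /eqP -> /andP[H _]; exists w' => //; rewrite inE.
    by case=> w1; rewrite inE => H [-> ->]; rewrite H eqxx.
  rewrite finset.cardsX; case: #|Q m| => [|q] /=; first by lia.
  by lia.
rewrite cP2 -(@card_in_imset _ _ h) => [|ww ww']; last first.
  rewrite !inE => /andP[/andP[/andP[r1 _] /andP[r2 _]] _] /andP[/andP[/andP[r1' _] /andP[r2' _]] _] /ffunP E.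
  have := congr1 s (E (true, ord0)); have := congr1 s (E (false, ord0)); rewrite !ffunE /=.
  have H w : w \in roots -> s (dart w) = w by move=> wr; have [] := dartP w 0%N wr.
  by rewrite !H // => e2 e1; rewrite [ww]surjective_pairing [ww']surjective_pairing e1 e2.
apply: subset_leq_card; apply/fintype.subsetP => g /imsetP[[w1 w2]].
rewrite !inE /= => /andP[/andP[/andP[r1 /eqP o1] /andP[r2 /eqP o2]] n12] ->.
have rb b : (if b then w1 else w2) \in roots by case: b.
have ob b : fingraph.order p (if b then w1 else w2) = m by case: b.
apply/andP; split.
  apply/injectiveP => -[b k] [b' k']; rewrite !ffunE /= -/s.
  have [-> _] := dartP _ k (rb b); have [-> _] := dartP _ k' (rb b') => E.
  have [|| wE kE] := iter_inj (rb b) (rb b') _ _ E; rewrite ?ob //.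
  congr pair; last exact: ord_inj.
  by move: wE n12; clear E; case: b; case: b' => // ->; rewrite eqxx.
apply/forallP => -[b k]; rewrite !ffunE /= -/s -/t; apply/eqP.
have [_ ->] := dartP _ k (rb b); have [-> _] := dartP _ (k.+1 %% m)%N (rb b).
have [km|km] := ltnP k.+1 m; first by rewrite modn_small.
have -> : k.+1 = m by apply/eqP; rewrite eqn_leq km ltn_ord.
by rewrite modnn /= -iterS -[X in iter X](ob b) (iter_order (@perm_inj _ p)).
Qed.

Lemma odd_cut_perm (l K : nat) : (0 < l)%N ->
  (forall m, (m < l)%N -> odd m -> (#|cycle_pairs m| < K * K)%N) ->
  exists X : {set F * bool}, [/\ (#|X| <= l * K + #|W| %/ l)%N, X \subset M & colourable ends (M :\: X)].
Proof.
move=> l0 HK; exists X; split; [|by apply/fintype.subsetP => d; rewrite inE => /andP[]|exact: X_colourable].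
have -> : #|X| = #|roots|.
  rewrite /roots card_in_imset // => d d'; rewrite !inE => /andP[dM _] /andP[d'M _].
  by case/double_cover_matchingP: mM => _; apply.
rewrite -(cardsID [set w | (fingraph.order p w < l)%N]%SET roots); apply: leq_add; last first.
  rewrite leq_divRL //; apply: leq_trans (long_roots l); rewrite leq_mul2r; apply/orP; right.
  by apply: subset_leq_card; apply/fintype.subsetP => w; rewrite !inE -leqNgt andbC.
apply: (@leq_trans (\sum_(m < l) #|Q m|)).
  rewrite -sum1_card (partition_big (fun w => insubd (Ordinal l0) (fingraph.order p w)) xpredT) //=.
  apply: leq_sum => m _; rewrite sum1_card; apply: subset_leq_card.
  apply/fintype.subsetP => w; rewrite unfold_in !inE => /andP[/andP[-> wl] /eqP <-] /=.
  by rewrite val_insubd wl.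
have -> : (l * K = \sum_(m < l) K)%N by rewrite sum_nat_const card_ord.
apply: leq_sum => m _; have [om|em] := boolP (odd m).
  (* [q (q - 1) < K^2] forces [q <= K]. *)
  have := leq_ltn_trans (Q_pairs m) (HK m (ltn_ord m) om).
  by case: #|Q m| => //= q; nia.
suff -> : Q m = finset.set0 by rewrite cards0.
apply/setP => w; rewrite !inE; apply/negP => /andP[/root_rt[_ + _] /eqP E].
by rewrite E (negPf em).
Qed.
End OddCut.

Lemma odd_cut (W F : finType) (ends : F -> W * W) (M : {set F * bool}) (l K : nat) :
  is_matching (double_cover ends) M -> (0 < l)%N ->
  (forall m, (m < l)%N -> odd m -> (#|cycle_pairs ends m| < K * K)%N) ->
  exists X : {set F * bool}, [/\ (#|X| <= l * K + #|W| %/ l)%N, X \subset M & colourable ends (M :\: X)].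
Proof.
move=> mM l0 HK; have [Hs Ht] := double_cover_matchingP _ _ mM.
have sub : {subset enum M <= M} by move=> d; rewrite mem_enum.
have [p pE] := perm_extend (enum_uniq M) (sub_in2 sub Hs) (sub_in2 sub Ht).
by apply: (@odd_cut_perm _ _ _ M mM p _ l K) => // d dM; apply: pE; rewrite mem_enum.
Qed.

(** * Coverings *)

Section Covering.
Variables (R : realType) (V E V' E' : finType) (ends : E -> V * V) (ends' : E' -> V' * V').
Variables (q : V' -> V) (r : E' -> E) (N : nat).
Hypothesis fibE : forall e, #|[set e' | r e' == e]%SET| = N.
Hypothesis fibV : forall v, #|[set v' | q v' == v]%SET| = N.
Hypothesis local_iso : forall (x : E -> R) v', vsum ends' (x \o r) v' = vsum ends x (q v').

Let sum_fib (I J : finType) (h : I -> J) (G : J -> R) :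
  (forall j, #|[set i | h i == j]%SET| = N) -> \sum_i G (h i) = N%:R * \sum_j G j.
Proof.
move=> fib; rewrite (partition_big h xpredT) //= mulr_sumr; apply: eq_bigr => j _.
rewrite (eq_bigr (fun=> G j)) => [|i /eqP -> //].
by rewrite sumr_const -(fib j) mulr_natl; congr (_ *+ _); apply: eq_card => i; rewrite inE.
Qed.

Lemma covering_edge_sum (x : E -> R) : edge_sum (x \o r) = N%:R * edge_sum x.
Proof. exact: sum_fib fibE. Qed.

(** The entropy is a sum of terms local to an edge or a vertex, so only fibre sizes and vertex sums
    matter. Used for the double cover with [N = 2] and for lifts with [N = n]. *)
Lemma covering_bethe (x : E -> R) : bethe ends' (x \o r) = N%:R * bethe ends x.
Proof.
rewrite /bethe mulrBr; congr (_ - _); last first.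
  rewrite -(sum_fib (fun v => xlnx (1 - vsum ends x v)) fibV).
  by apply: eq_bigr => v _; rewrite local_iso.
exact: (sum_fib (fun e => - xlnx (x e) + xlnx (1 - x e))).
Qed.

Lemma covering_FM (x : E -> R) : FM ends x -> FM ends' (x \o r).
Proof. by move=> [x0 x1]; split=> [e|v]; [exact: x0|rewrite local_iso; exact: x1]. Qed.
End Covering.

Section Instances.
Variables (R : realType) (V E : finType) (ends : E -> V * V).
Hypothesis Hl : loopless ends.

Lemma vsum_double_cover (x : E -> R) v :
  vsum (double_cover ends) (x \o fst) v = vsum ends x v.1.
Proof.
rewrite /vsum [LHS]big_mkcond [RHS]big_mkcond /=.
rewrite (eq_bigr (fun d => (fun e o => if incident (double_cover ends) v (e, o) then x e else 0) d.1 d.2)) => [|[]//].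
rewrite -(pair_bigA _ (fun e o => if incident (double_cover ends) v (e, o) then x e else 0)) /=.
apply: eq_bigr => e _; rewrite big_bool /= /incident /= /dsrc /dtgt /=; have := Hl e.
case: v => v o ab.
have nab : ~~ (((ends e).1 == v) && ((ends e).2 == v)).
  by apply: contra ab => /andP[/eqP -> /eqP ->].
rewrite !xpair_eqE /=; move: nab; case: o; case: (_ == v); case: (_ == v) => //= _;
by rewrite ?add0r ?addr0.
Qed.

Lemma card_fst_bool (T : finType) (t : T) : #|[set d : T * bool | d.1 == t]%SET| = 2%N.
Proof.
rewrite -[RHS]card_bool -(card_imset _ (f := fun o : bool => (t, o))); last by move=> ? ? [].
apply: eq_card => -[t' o]; rewrite inE /=; apply/eqP/imsetP => [->|[? _ [-> _]]//].
by exists o.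
Qed.

Lemma double_cover_bethe (x : E -> R) :
  bethe (double_cover ends) (x \o fst) = 2 * bethe ends x.
Proof. exact: covering_bethe (@card_fst_bool E) (@card_fst_bool V) vsum_double_cover _. Qed.

Lemma double_cover_edge_sum (x : E -> R) : edge_sum (x \o fst : E * bool -> R) = 2 * edge_sum x.
Proof. exact: (covering_edge_sum (@card_fst_bool E)). Qed.

Lemma double_cover_FM (x : E -> R) : FM ends x -> FM (double_cover ends) (x \o fst).
Proof. exact: covering_FM vsum_double_cover _. Qed.

Variables (n : nat) (s : nlift E n).
Local Notation L := (lift_ends ends s).

Lemma loopless_lift : loopless L.
Proof. by move=> [e i] /=; apply: contra (Hl e) => /eqP[-> _]. Qed.

Lemma bipartite_lift : bipartite_graph ends -> bipartite_graph L.
Proof. by move=> [c Hc]; exists (fun v => c v.1) => -[e i]; exact: Hc. Qed.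

Lemma vsum_lift (x : E -> R) v : vsum L (x \o fst) v = vsum ends x v.1.
Proof.
rewrite /vsum [LHS]big_mkcond [RHS]big_mkcond /=.
rewrite (eq_bigr (fun d => (fun e i => if incident L v (e, i) then x e else 0) d.1 d.2)) => [|[]//].
rewrite -(pair_bigA _ (fun e i => if incident L v (e, i) then x e else 0)) /=.
apply: eq_bigr => e _; rewrite -big_mkcond /=; case: v => v j.
have nab : ~~ (((ends e).1 == v) && ((ends e).2 == v)).
  by apply: contra (Hl e) => /andP[/eqP -> /eqP ->].
under eq_bigl => i do rewrite /incident /= !xpair_eqE.
rewrite /incident; move: nab; case: (_ == v); case: (_ == v) => //= _.
- by under eq_bigl => i do rewrite orbF; rewrite big_pred1_eq.
- rewrite (eq_bigl (fun i => i == (s e)^-1 j)%g) => [|i]; first by rewrite big_pred1_eq.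
  by rewrite -(inj_eq (@perm_inj _ (s e)) i) permKV.
- by rewrite big_pred0.
Qed.

Lemma card_fst_ord (T : finType) (t : T) : #|[set d : T * 'I_n | d.1 == t]%SET| = n.
Proof.
rewrite -[RHS]card_ord -(card_imset _ (f := fun o : 'I_n => (t, o))); last by move=> ? ? [].
apply: eq_card => -[t' o]; rewrite inE /=; apply/eqP/imsetP => [->|[? _ [-> _]]//].
by exists o.
Qed.

Lemma lift_bethe (x : E -> R) : bethe L (x \o fst) = n%:R * bethe ends x.
Proof. exact: covering_bethe (@card_fst_ord E) (@card_fst_ord V) vsum_lift _. Qed.

Lemma lift_edge_sum (x : E -> R) : edge_sum (x \o fst : E * 'I_n -> R) = n%:R * edge_sum x.
Proof. exact: (covering_edge_sum (@card_fst_ord E)). Qed.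

Lemma lift_FM (x : E -> R) : FM ends x -> FM L (x \o fst).
Proof. exact: covering_FM vsum_lift _. Qed.
End Instances.

(** * Short cycles in random lifts *)

Section Constraints.
Local Open Scope nat_scope.
Variables (E : finType) (n : nat).
Implicit Types (s : nlift E n) (c : E * 'I_n * 'I_n) (Q : seq (E * 'I_n * 'I_n)).

Definition lift_sat s Q := all (fun c => s c.1.1 c.1.2 == c.2) Q.

(** Switching: in a lift with [s e i = j], exchanging the value [j] with any [j'] not prescribed by
    [Q] keeps [Q] satisfied, and both the lift and [j'] can be recovered. So the extra constraint
    has conditional probability at most [1 / (n - size Q)]. *)
Lemma lift_sat_cons c Q : uniq (map fst (c :: Q)) ->
  #|[set s | lift_sat s (c :: Q)]%SET| * (n - size Q) <= #|[set s | lift_sat s Q]%SET|.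
Proof.
case: c => [[e i] j] /= /andP[cQ _].
pose J := [set j' | j' \notin map snd Q]%SET.
have cJ : n - size Q <= #|J|.
  have -> : J = (~: [set j' in map snd Q])%SET by apply/setP => j'; rewrite !inE.
  rewrite cardsCs finset.setCK card_ord leq_sub2l // cardsE.
  by apply: leq_trans (card_size _) _; rewrite size_map.
apply: (@leq_trans (#|[set s | lift_sat s (((e, i), j) :: Q)]%SET| * #|J|)).
  by rewrite leq_mul2l cJ orbT.
pose h (p : nlift E n * 'I_n) : nlift E n :=
  [ffun e' => if e' == e then (p.1 e * tperm j p.2)%g else p.1 e'].
rewrite -finset.cardsX -(@card_in_imset _ _ h).
  apply: subset_leq_card; apply/fintype.subsetP => s' /imsetP[[s j']].
  rewrite !inE /= => /andP[/andP[/eqP sj /allP sQ] jJ] ->; apply/allP => -[[e1 i1] j1] c1Q /=.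
  have /eqP /= s1 := sQ _ c1Q; rewrite ffunE; case: (e1 =P e) => [e1e|_]; last by rewrite /= s1.
  rewrite permM /=; rewrite e1e in s1 c1Q *; rewrite s1 tpermD //.
    rewrite -sj -s1 (inj_eq (@perm_inj _ (s e))); apply: contraNneq cQ => ->.
    by apply/mapP; exists ((e, i1), j1).
  by apply: contraNneq jJ => ->; apply/mapP; exists ((e, i1), j1).
move=> [s j1] [s' j1']; rewrite !inE /= => /andP[/andP[/eqP sj _] _] /andP[/andP[/eqP sj' _] _].
move=> /ffunP H; have := H e; rewrite !ffunE eqxx /= => He.
have jj : j1 = j1'.
  by have := congr1 (fun p : {perm 'I_n} => p i) He; rewrite !permM /= sj sj' !tpermL.
congr pair => //; apply/ffunP => e'; have := H e'; rewrite !ffunE.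
case: eqP => [-> _|//]; move: He; rewrite /= jj; exact: mulIg.
Qed.

Lemma lift_sat_card Q : uniq (map fst Q) ->
  #|[set s | lift_sat s Q]%SET| * (n - size Q) ^ size Q <= #|{: nlift E n}|.
Proof.
elim: Q => [_|c Q IH uQ]; first by rewrite expn0 muln1 max_card.
have /= /andP[_ uQ'] := uQ.
apply: leq_trans (IH uQ'); rewrite /= expnS mulnA leq_mul //.
  by apply: leq_trans (lift_sat_cons uQ); rewrite leq_mul2l leq_sub2l ?orbT.
by case: (size Q) => // k; rewrite leq_exp2r // leq_sub2l.
Qed.
End Constraints.

Section CycleMoment.
Local Open Scope nat_scope.
Variables (V E : finType) (ends : E -> V * V) (n m : nat).
Hypothesis om : odd m.

Let I : finType := (bool * 'I_m)%type.
Let nx (k : I) : I := (k.1, ordS k.2).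
Let code := {ffun I -> (E * bool) * 'I_n}.

Let constr (c : code) (k : I) : E * 'I_n * 'I_n :=
  let l := (c k).2 in let l' := (c (nx k)).2 in
  ((c k).1.1, if (c k).1.2 then l' else l, if (c k).1.2 then l else l').

Let constrs c := map (constr c) (enum I).

Let encode (s : nlift E n) (g : {ffun I -> (E * 'I_n) * bool}) : code :=
  [ffun k => (((g k).1.1, (g k).2), (dsrc (lift_ends ends s) (g k)).2)].

Let encode_inj s : injective (encode s).
Proof.
move=> g g' /ffunP H; apply/ffunP => k; have := H k; rewrite !ffunE.
case: (g k) => -[e i] o; case: (g' k) => -[e' i'] o' [/= <- <-].
by rewrite /dsrc /=; case: o => /= [/perm_inj ->|->].
Qed.

(** This is where odd length enters: a cycle of length 2 could run back and forth along one edge of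
    the lift and would impose only one constraint. *)
Let nx_ne (k : I) : nx (nx k) = k -> nx k = k.
Proof.
case: k => b k; rewrite /nx /= => -[/(congr1 val) /= H]; congr pair; apply: val_inj => /=.
move: H; have := ltn_ord k; move: (nat_of_ord k) => {}k km.
have [k1|k1] := ltnP k.+1 m; last first.
  have -> : k.+1 = m by apply/eqP; rewrite eqn_leq km.
  rewrite modnn; have [m1|m1] := ltnP 1 m; first by rewrite modn_small //; lia.
  by lia.
rewrite (@modn_small k.+1) //; have [k2|k2] := ltnP k.+2 m; first by rewrite modn_small //; lia.
by have -> : k.+2 = m; [apply/eqP; rewrite eqn_leq k1|rewrite modnn; move: om; lia].
Qed.

Let encode_sat s g : g \in cycle_pairs (lift_ends ends s) m ->
  uniq (map fst (constrs (encode s g))) && lift_sat s (constrs (encode s g)).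
Proof.
rewrite inE => /andP[/injectiveP ginj /forallP gnx].
have gn k : dtgt (lift_ends ends s) (g k) = dsrc (lift_ends ends s) (g (nx k)) by apply/eqP.
have keyE k : (constr (encode s g) k).1 = (g k).1.
  rewrite /constr !ffunE /= -gn; case: (g k) => -[e i] o.
  by rewrite /dsrc /dtgt /=; case: o.
apply/andP; split.
  rewrite -map_comp (eq_map keyE) map_inj_uniq ?enum_uniq //.
  move=> k k' E1; apply: (ginj).
  (* Two positions on the same edge of the lift carry either the same dart, excluded by injectivity,
     or opposite darts, each of which must then follow the other. *)
  have [E2|E2] := eqVneq (g k).2 (g k').2; first by rewrite [g k]surjective_pairing E1 E2 -surjective_pairing.
  have st d d' : d.1 = d'.1 -> d.2 != d'.2 -> dtgt (lift_ends ends s) d = dsrc (lift_ends ends s) d'.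
    by case: d d' => [ei o] [ei' o'] /= ->; rewrite /dtgt /dsrc /=; case: o; case: o'.
  have n1 : nx k = k' by apply: (ginj); rewrite -gn; apply: st.
  have n2 : nx k' = k by apply: (ginj); rewrite -gn; apply: st; rewrite // eq_sym.
  have : nx (nx k) = k by rewrite n1 n2.
  by move/nx_ne; rewrite n1 => ->.
apply/allP => c /mapP[k _ ->]; have := gn k.
rewrite /constr !ffunE /= -gn; case: (g k) => -[e i] o _.
by rewrite /dsrc /dtgt /=; case: o.
Qed.

(** There are [(2 #|E| n)^(2m)] codes, and a code with distinct keys imposes [2m] constraints, each
    costing about [1/n]. The powers of [n] balance and the mean stays bounded. *)
Lemma cycle_moment :
  (\sum_(s : nlift E n) #|cycle_pairs (lift_ends ends s) m|) * (n - 2 * m) ^ (2 * m)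
    <= (2 * #|E| * n) ^ (2 * m) * #|{: nlift E n}|.
Proof.
have cI : #|I| = 2 * m by rewrite card_prod card_bool card_ord.
pose ok s c := uniq (map fst (constrs c)) && lift_sat s (constrs c).
apply: (@leq_trans ((\sum_(s : nlift E n) \sum_(c | ok s c) 1) * (n - 2 * m) ^ (2 * m))).
  rewrite leq_mul2r; apply/orP; right; apply: leq_sum => s _.
  rewrite sum1_card -(card_imset _ (@encode_inj s)); apply: subset_leq_card.
  by apply/fintype.subsetP => c /imsetP[g gC ->]; rewrite unfold_in; exact: encode_sat.
rewrite (exchange_big_dep xpredT) //= big_distrl /=.
have -> : (2 * #|E| * n) ^ (2 * m) * #|{: nlift E n}| = \sum_(c : code) #|{: nlift E n}|.
  rewrite sum_nat_const (_ : #|_| = #|{: code}|); last exact: eq_card.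
  by congr (_ * _); rewrite card_ffun cI !card_prod !card_bool !card_ord; congr (_ ^ _); lia.
apply: leq_sum => c _.
have sQ : size (constrs c) = 2 * m by rewrite size_map -cardE.
have [uc|nuc] := boolP (uniq (map fst (constrs c))); last first.
  by rewrite big_pred0 // => s; rewrite /ok (negPf nuc).
rewrite sum1_card; have := lift_sat_card uc; rewrite sQ; apply: leq_trans.
rewrite leq_mul2r; apply/orP; right; apply: subset_leq_card; apply/fintype.subsetP => s.
by rewrite inE unfold_in /ok uc.
Qed.
End CycleMoment.

(** * First moment of the number of matchings *)

Section Binomial.
Local Open Scope nat_scope.
(** Up to the factor [n^n] these are the binomial probabilities with parameter [k/n]. The ratio of
    consecutive terms shows that they increase up to [k] and decrease after it. *)
Lemma binomial_mode (n k j : nat) : 0 < k < n -> j <= n ->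
  'C(n, j) * (k ^ j * (n - k) ^ (n - j)) <= 'C(n, k) * (k ^ k * (n - k) ^ (n - k)).
Proof.
move=> /andP[k0 kn] jn; pose B j := 'C(n, j) * (k ^ j * (n - k) ^ (n - j)).
have ratio i : i < n -> B i.+1 * (i.+1 * (n - k)) = B i * ((n - i) * k).
  move=> ni; rewrite /B expnS (_ : n - i = (n - i.+1).+1); last by lia.
  have := mul_bin_left n i; rewrite expnS; set c := 'C(n, i.+1); set c' := 'C(n, i).
  rewrite (_ : n - i = (n - i.+1).+1); last by lia.
  set a := k ^ i; set b := (n - k) ^ (n - i.+1) => H.
  transitivity (i.+1 * c * (k * a * b * (n - k))); first by ring.
  by rewrite H; ring.
have up i : i < k -> B i <= B i.+1.
  move=> ik; have h1 : 0 < i.+1 * (n - k) by nia.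
  rewrite -(leq_pmul2r h1) ratio; last by lia.
  rewrite leq_mul2l; apply/orP; right; nia.
have down i : k <= i -> i < n -> B i.+1 <= B i.
  move=> ki ni; have h1 : 0 < i.+1 * (n - k) by nia.
  rewrite -(leq_pmul2r h1) ratio // leq_mul2l; apply/orP; right; nia.
have [jk|kj] := leqP j k.
  have H d : d <= k -> B (k - d) <= B k.
    elim: d => [_|d IH dk]; first by rewrite subn0.
    apply: leq_trans (IH (ltnW dk)); have := up (k - d.+1).
    by rewrite (_ : (k - d.+1).+1 = k - d); [apply; lia|lia].
  by have := H (k - j); rewrite subKn //; apply; lia.
have H d : k + d <= n -> B (k + d) <= B k.
  elim: d => [_|d IH dk]; first by rewrite addn0.
  rewrite addnS; apply: leq_trans (IH _); last by lia.
  by apply: down; lia.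
by have := H (j - k); rewrite subnKC //; [apply|lia].
Qed.

(** The largest of the [n + 1] terms in the expansion of [(k + (n - k))^n] is at least their
    average. *)
Lemma binomial_lower (n k : nat) : k <= n ->
  n ^ n <= n.+1 * ('C(n, k) * (k ^ k * (n - k) ^ (n - k))).
Proof.
move=> kn; have [->|k0] := posnP k.
  by rewrite bin0 expn0 subn0 !mul1n mulSn leq_addr.
have [->|kn'] := eqVneq k n; first by rewrite binn subnn expn0 muln1 mul1n mulSn leq_addr.
have {kn kn'}kn : k < n by rewrite ltn_neqAle kn' kn.
rewrite -[X in X ^ _](subnK (ltnW kn)) expnDn.
rewrite (_ : n.+1 * _ = \sum_(i < n.+1) 'C(n, k) * (k ^ k * (n - k) ^ (n - k))); last first.
  by rewrite sum_nat_const card_ord.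
apply: leq_sum => i _; rewrite [(_ ^ _ * k ^ _)]mulnC; apply: binomial_mode; first by rewrite k0.
by rewrite -ltnS.
Qed.
End Binomial.

Section Entropy.
Variable R : realType.

Lemma expr_xlnx (y : R) (n N : nat) : 0 <= y -> N%:R = n%:R * y ->
  y ^+ N = expR (n%:R * xlnx y).
Proof.
move=> y0 Ny; rewrite /xlnx; case: eqP Ny => [->|/eqP yn].
  by rewrite mulr0 expR0 => /eqP; rewrite pnatr_eq0 => /eqP ->; rewrite expr0.
have yp : 0 < y by rewrite lt_def yn.
by rewrite mulrA => <-; rewrite expRM_natl lnK ?posrE.
Qed.

Lemma binomial_entropy (n k : nat) (y : R) : (0 < n)%N -> (k <= n)%N -> y = k%:R / n%:R ->
  expR (- (n%:R * (xlnx y + xlnx (1 - y)))) <= n.+1%:R * 'C(n, k)%:R.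
Proof.
move=> n0 kn ye; have np : (0 : R) < n%:R by rewrite ltr0n.
have y0 : 0 <= y by rewrite ye divr_ge0.
have y1 : 0 <= 1 - y by rewrite subr_ge0 ye ler_pdivrMr // mul1r ler_nat.
have ky : k%:R = n%:R * y by rewrite ye mulrC divfK // gt_eqF.
have nky : (n - k)%:R = n%:R * (1 - y) by rewrite natrB // ky mulrBr mulr1.
rewrite expRN mulrDr expRD -(expr_xlnx y0 ky) -(expr_xlnx y1 nky).
have := binomial_lower kn; rewrite -(ler_nat R) !natrM !natrX ky nky !exprMn.
have -> : n%:R ^+ n = n%:R ^+ k * n%:R ^+ (n - k) :> R by rewrite -exprD subnKC.
have D0 : 0 < n%:R ^+ k * n%:R ^+ (n - k) :> R by rewrite mulr_gt0 // exprn_gt0.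
move=> H; have {}H : 1 <= n.+1%:R * 'C(n, k)%:R * (y ^+ k * (1 - y) ^+ (n - k)).
  rewrite -(ler_pM2r D0) mul1r; apply: le_trans H _; rewrite le_eqVlt; apply/orP; left; apply/eqP.
  by ring.
have P0 : 0 < y ^+ k * (1 - y) ^+ (n - k).
  rewrite lt_def mulr_ge0 ?exprn_ge0 // andbT; apply/eqP => E.
  by move: H; rewrite E mulr0 ler10.
by rewrite -[leLHS]mul1r ler_pdivrMr.
Qed.
End Entropy.

Section PermImage.
Variable n : nat.

Lemma card_perm_image (A B B' : {set 'I_n}) : #|B| = #|B'| ->
  #|[set t : {perm 'I_n} | t @: A == B]%SET| = #|[set t : {perm 'I_n} | t @: A == B']%SET|.
Proof.
move=> BB'.
have [p pE] : exists p : {perm 'I_n}, {in enum 'I_#|B|, forall i, p (enum_val i) = enum_val (cast_ord BB' i)}.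
  apply: perm_extend; rewrite ?enum_uniq //; move=> i j _ _; first exact: enum_val_inj.
  by move/enum_val_inj/cast_ord_inj.
have pB : p @: B = B'.
  apply/eqP; rewrite eqEcard card_imset ?BB' ?leqnn ?andbT; last exact: perm_inj.
  apply/fintype.subsetP => _ /imsetP[j jB ->].
  by rewrite -(enum_rankK_in jB jB) pE ?mem_enum // enum_valP.
rewrite -(card_imset _ (mulIg p)); apply: eq_card => t; rewrite [RHS]inE; apply/imsetP/eqP.
  case=> u; rewrite inE => /eqP uA ->; rewrite -pB -uA -imset_comp.
  by apply: eq_imset => i /=; rewrite permM.
move=> tA; exists (t * p^-1)%g; last by rewrite mulgKV.
rewrite inE -(inj_eq (imset_inj (@perm_inj _ p))) pB -tA -imset_comp; apply/eqP.
by apply: eq_imset => i /=; rewrite permM permKV.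
Qed.

(** By symmetry, the image of [A] under a uniform permutation is uniform among the sets of its
    size. *)
Lemma perm_image_bound (A B : {set 'I_n}) : #|B| = #|A| ->
  (#|[set t : {perm 'I_n} | t @: A == B]%SET| * 'C(n, #|A|) <= #|{: {perm 'I_n}}|)%N.
Proof.
move=> BA; rewrite -[#|{: {perm 'I_n}}|]sum1_card.
rewrite (partition_big (fun t : {perm 'I_n} => t @: A) (fun B' => #|B'| == #|A|)) /=; last first.
  by move=> t _; rewrite card_imset //; exact: perm_inj.
rewrite -[n in 'C(n, _)]card_ord -card_draws mulnC -sum_nat_const.
rewrite [leqLHS](eq_bigl (fun B' : {set 'I_n} => #|B'| == #|A|)); last by move=> B'; rewrite inE.
apply: leq_sum => B' /eqP B'A; rewrite sum1_card (card_perm_image _ (etrans BA (esym B'A))).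
by apply/eq_leq/eq_card => t; rewrite inE.
Qed.
End PermImage.

Lemma big_option_add (R : nmodType) (T : finType) (f : option T -> R) :
  \sum_o f o = f None + \sum_t f (Some t).
Proof.
rewrite (bigD1 None) //=; congr (_ + _).
rewrite (reindex_omap Some id) => [|[]//]; by apply: eq_bigl => t /=; rewrite eqxx.
Qed.

Section FirstMoment.
Variables (R : realType) (V E : finType) (ends : E -> V * V) (n : nat).
Hypothesis Hl : loopless ends.
Local Notation a e := (ends e).1.
Local Notation b e := (ends e).2.
Local Notation L s := (lift_ends ends s).

Definition fibre (M : {set E * 'I_n}) (e : E) : {set 'I_n} := [set i | (e, i) \in M]%SET.

Definition mtype (M : {set E * 'I_n}) : {ffun E -> 'I_n.+1} :=
  [ffun e => inord #|fibre M e|].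

Lemma mtypeE M e : mtype M e = #|fibre M e| :> nat.
Proof. by rewrite ffunE inordK // ltnS -[X in (_ <= X)%N]card_ord max_card. Qed.

Definition type_count (s : nlift E n) (k : {ffun E -> 'I_n.+1}) : nat :=
  #|[set M : {set E * 'I_n} | is_matching (L s) M && (mtype M == k)]%SET|.

Lemma sum_mtype M : (\sum_e mtype M e = #|M|)%N.
Proof.
rewrite -sum1_card [RHS]big_mkcond /=.
rewrite [RHS](eq_bigr (fun d => if (d.1, d.2) \in M then 1 else 0)%N) => [|[]//].
rewrite -(pair_bigA _ (fun e i => if (e, i) \in M then 1 else 0)%N) /=.
by apply: eq_bigr => e _; rewrite -big_mkcond /= mtypeE -sum1_card; apply: eq_bigl => i; rewrite inE.
Qed.

Lemma match_poly_types s (z : R) :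
  match_poly (L s) z = \sum_(k : {ffun E -> 'I_n.+1}) (type_count s k)%:R * z ^+ (\sum_e k e)%N.
Proof.
rewrite match_poly_sum (partition_big mtype xpredT) //=; apply: eq_bigr => k _.
rewrite /type_count -sum1_card natr_sum mulr_suml.
apply: eq_big => [M|M /andP[_ /eqP <-]]; first by rewrite inE.
by rewrite mul1r sum_mtype.
Qed.

Lemma nmatch_types s (m : nat) :
  nmatch (L s) m = (\sum_(k : {ffun E -> 'I_n.+1} | \sum_e k e == m) type_count s k)%N.
Proof.
rewrite /nmatch -sum1_card (partition_big mtype (fun k : {ffun E -> 'I_n.+1} => \sum_e k e == m)%N) /=.
  apply: eq_bigr => k /eqP km; rewrite /type_count -sum1_card; apply: eq_bigl => M; rewrite !inE.
  case: (mtype M =P k) => [Mk|_]; rewrite ?andbF // !andbT.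
  by rewrite -sum_mtype Mk km eqxx andbT.
by move=> M; rewrite inE sum_mtype => /andP[].
Qed.

(** A family records, for each edge of [G], the vertices that a matching covers over its two ends.
    The lift then only has to map one set onto the other, which separates counting families from the
    probability over lifts. *)
Let fam := {ffun E -> {set 'I_n} * {set 'I_n}}.
Let X (ab : fam) (v : V) (e : E) : {set 'I_n} := if a e == v then (ab e).1 else (ab e).2.

Let valid (k : E -> nat) (ab : fam) :=
  [forall e, (#|(ab e).1| == k e) && (#|(ab e).2| == k e)] &&
  [forall v, forall e, forall f, [&& incident ends v e, incident ends v f & e != f] ==>
     [disjoint X ab v e & X ab v f]].

Let col (ab : fam) : {ffun V * 'I_n -> option E} :=
  [ffun vj => [pick e | incident ends vj.1 e && (vj.2 \in X ab vj.1 e)]].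

Let colP k ab v j e : valid k ab ->
  (col ab (v, j) == Some e) = incident ends v e && (j \in X ab v e).
Proof.
move=> /andP[_ /forallP/(_ v)/forallP D]; rewrite ffunE /=; apply/eqP/andP.
  by case: pickP => // f /andP[ve je] [<-].
case=> ve je; case: pickP => [f /andP[vf jf]|/(_ e)]; last by rewrite ve je.
congr Some; apply/eqP; apply: contraT => fe.
have /forallP/(_ f)/implyP := D e; rewrite ve vf eq_sym fe => /(_ isT).
by rewrite disjoint_subset => /fintype.subsetP/(_ j je); rewrite !inE jf.
Qed.

Let X_card k ab v e : valid k ab -> #|X ab v e| = k e.
Proof. by move=> /andP[/forallP/(_ e)/andP[/eqP ? /eqP ?] _]; rewrite /X; case: ifP. Qed.

Let col_count k ab v e : valid k ab ->
  #|[set j | col ab (v, j) == Some e]%SET| = (if incident ends v e then k e else 0)%N.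
Proof.
move=> vk; case: ifP => ve.
  rewrite -(X_card v e vk); apply: eq_card => j.
  by rewrite inE (colP _ _ _ vk) ve.
by apply: eq_card0 => j; rewrite inE (colP _ _ _ vk) ve.
Qed.

Let valid_sum k ab v : valid k ab ->
  (#|[set j | col ab (v, j) == None]%SET| + \sum_(e | incident ends v e) k e = n)%N.
Proof.
move=> vk; rewrite -[RHS]card_ord -[RHS]sum1_card.
rewrite [RHS](partition_big (fun j => col ab (v, j)) xpredT) //= [RHS]big_option_add.
apply: (congr2 addn); first by rewrite -sum1_card; apply: eq_bigl => j; rewrite inE.
rewrite big_mkcond; apply: eq_bigr => e _; rewrite -(col_count v e vk) -sum1_card.
by apply: eq_bigl => j; rewrite inE.
Qed.

Let col_inj k : {in valid k &, injective col}.
Proof.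
move=> ab ab' vk vk' E1; apply/ffunP => e.
have H v j : incident ends v e -> (j \in X ab v e) = (j \in X ab' v e).
  by move=> ve; have := colP v j e vk; have := colP v j e vk'; rewrite E1 => ->; rewrite ve.
rewrite [LHS]surjective_pairing [RHS]surjective_pairing; congr pair; apply/setP => j.
  by have := H (a e) j; rewrite /X /incident eqxx; apply.
by have := H (b e) j; rewrite /X /incident eqxx orbT (negPf (Hl e)); apply.
Qed.

Let ab_of (s : nlift E n) (M : {set E * 'I_n}) : fam :=
  [ffun e => (fibre M e, s e @: fibre M e)%SET].

Let ab_of_valid s M : is_matching (L s) M -> valid (fun e => mtype M e) (ab_of s M).
Proof.
move=> /is_matchingP mM; apply/andP; split.
  apply/forallP => e; rewrite ffunE mtypeE eqxx /= card_imset ?eqxx //; exact: perm_inj.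
apply/forallP => v; apply/forallP => e; apply/forallP => f; apply/implyP => /and3P[ve vf ef].
have XP g j : incident ends v g -> j \in X (ab_of s M) v g ->
    exists i, (g, i) \in M /\ incident (L s) (v, j) (g, i).
  rewrite /X ffunE /incident /= => vg; case: ifP vg => [/eqP <- _|_ /= /eqP <-].
    by rewrite inE => jM; exists j; rewrite jM eqxx.
  by case/imsetP => i; rewrite inE => iM ->; exists i; rewrite iM eqxx orbT.
rewrite disjoint_subset; apply/fintype.subsetP => j /(XP _ _ ve)[i [iM vi]]; rewrite inE.
apply/negP => /(XP _ _ vf)[i' [iM' vi']].
by have [/eqP] := mM _ _ _ iM iM' vi vi'; rewrite (negPf ef).
Qed.

Lemma matching_vsum s M v : is_matching (L s) M ->
  (\sum_(e | incident ends v e) mtype M e <= n)%N.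
Proof. by move=> /ab_of_valid/(valid_sum v) H; exact: leq_trans (leq_addl _ _) (eq_leq H). Qed.

Lemma matching_FM s M : (0 < n)%N -> is_matching (L s) M ->
  FM (R := R) ends (fun e => (mtype M e)%:R / n%:R).
Proof.
move=> n0 mM; split=> [e|v]; first by rewrite divr_ge0.
rewrite /vsum -mulr_suml ler_pdivrMr ?ltr0n // mul1r -natr_sum ler_nat.
exact: (matching_vsum v mM).
Qed.

Variable k : {ffun E -> 'I_n.+1}.
Let kk (e : E) : nat := k e.
Hypothesis n0 : (0 < n)%N.
Let x (e : E) : R := (k e)%:R / n%:R.
Hypothesis xFM : FM ends x.

(* When the colours [col ab (v, j)] are drawn independently with law [w v], every valid
   family has the same probability [w_prod]; its inverse bounds their number. *)
Let w (v : V) (o : option E) : R :=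
  if o is Some e then (if incident ends v e then x e else 0) else 1 - vsum ends x v.

Let w_ge0 v o : 0 <= w v o.
Proof.
case: xFM => x0 x1; case: o => [e|] /=; last by rewrite subr_ge0.
by case: ifP.
Qed.

Let w_sum v : \sum_o w v o = 1.
Proof. by rewrite big_option_add /= -big_mkcond /= subrK. Qed.

Let nx e : (k e)%:R = n%:R * x e.
Proof. by rewrite /x mulrC divfK // pnatr_eq0 -lt0n. Qed.

Let w_prod ab : valid kk ab -> \prod_(vj : V * 'I_n) w vj.1 (col ab vj) =
  expR (n%:R * \sum_v (xlnx (1 - vsum ends x v) + \sum_(e | incident ends v e) xlnx (x e))).
Proof.
move=> vk; case: xFM => x0 x1.
rewrite (eq_bigr (fun vj => (fun v j => w v (col ab (v, j))) vj.1 vj.2)) => [|[]//].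
rewrite -(pair_bigA _ (fun v j => w v (col ab (v, j)))) /= mulr_sumr expR_sum.
apply: eq_bigr => v _.
rewrite (partition_big (fun j => col ab (v, j)) xpredT) //=.
rewrite (eq_bigr (fun o => w v o ^+ #|[set j | col ab (v, j) == o]%SET|)); last first.
  move=> o _; rewrite (eq_bigr (fun=> w v o)) => [|j /eqP ->//].
  by rewrite prodr_const; congr (_ ^+ _); apply: eq_card => j; rewrite inE.
rewrite (bigD1 None) //= mulrDr expRD; congr (_ * _).
  apply: expr_xlnx; first by rewrite subr_ge0.
  have := valid_sum v vk => /(congr1 (fun m => m%:R : R)); rewrite natrD natr_sum.
  rewrite (eq_bigr (fun e => n%:R * x e)) => [|e _]; last exact: nx.
  by rewrite -mulr_sumr => H; rewrite mulrBr mulr1 /vsum; lra.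
rewrite (reindex_omap Some id) => [|[]//]; rewrite (eq_bigl xpredT); last by move=> e /=; rewrite eqxx.
rewrite mulr_sumr expR_sum [RHS]big_mkcond; apply: eq_bigr => e _ /=.
rewrite (col_count v e vk); case: ifP => // ve; apply: expr_xlnx; [exact: x0|exact: nx].
Qed.

Let valid_bound :
  #|[set ab | valid kk ab]%SET|%:R <=
  expR (- (n%:R * \sum_v (xlnx (1 - vsum ends x v) + \sum_(e | incident ends v e) xlnx (x e)))).
Proof.
rewrite expRN -[leRHS]mul1r ler_pdivlMr ?expR_gt0 // -sum1_card natr_sum mulr_suml.
rewrite [leLHS](eq_bigr (fun ab => \prod_(vj : V * 'I_n) w vj.1 (col ab vj))); last first.
  by move=> ab; rewrite inE mul1r => vk; rewrite (w_prod vk).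
rewrite [leLHS](eq_bigl (valid kk)) => [|ab]; last by rewrite inE.
have E1 : \sum_(c : {ffun V * 'I_n -> option E}) \prod_vj w vj.1 (c vj) = 1.
  by rewrite -(bigA_distr_bigA (fun vj o => w vj.1 o)) big1.
rewrite -[leRHS]E1.
apply: (@ler_sum_inj R _ _ (valid kk) xpredT col
  (fun c : {ffun V * 'I_n -> option E} => \prod_vj w vj.1 (c vj))) => //.
by move=> c; apply: prodr_ge0.
Qed.

Let image_bound ab : valid kk ab ->
  (#|[set s : nlift E n | [forall e, s e @: (ab e).1 == (ab e).2]]%SET|
   * \prod_e 'C(n, k e) <= #|{: nlift E n}|)%N.
Proof.
move=> /andP[/forallP vk _].
have -> : #|[set s : nlift E n | [forall e, s e @: (ab e).1 == (ab e).2]]%SET| =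
   (\prod_e #|[set t : {perm 'I_n} | t @: (ab e).1 == (ab e).2]%SET|)%N.
  rewrite -sum1_card (eq_bigr (fun e => \sum_(t : {perm 'I_n}) (t @: (ab e).1 == (ab e).2 : nat)))%N.
    rewrite bigA_distr_bigA /= big_mkcond /=; apply: eq_bigr => s _; rewrite inE.
    case: ifP => [/forallP H|/negbT].
      by rewrite big1 // => e _; rewrite H.
    rewrite negb_forall => /existsP[e ne]; by rewrite (bigD1 e) //= (negPf ne).
  by move=> e _; rewrite -sum1_card big_mkcond /=; apply: eq_bigr => t _; rewrite inE; case: eqP.
rewrite card_ffun -big_split /= -prod_nat_const.
rewrite [leqRHS](eq_bigl xpredT) //; apply: leq_prod => e _.
have /andP[/eqP e1 /eqP e2] := vk e.
by have := @perm_image_bound n (ab e).1 (ab e).2; rewrite e1 e2 => /(_ erefl).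
Qed.

(** Families count [- xlnx (x e)] at both ends of [e]; the probability [1 / 'C(n, k e)] of matching
    the two sets takes one copy back and leaves [xlnx (1 - x e)]. The power of [n.+1] comes from
    [binomial_entropy], once per edge. *)
Theorem first_moment :
  (\sum_(s : nlift E n) type_count s k)%N%:R <=
  #|{: nlift E n}|%:R * n.+1%:R ^+ #|E| * expR (n%:R * bethe ends x).
Proof.
set N := #|{: nlift E n}|.
have C0 : 0 < \prod_e 'C(n, k e)%:R :> R.
  by apply: prodr_gt0 => e _; rewrite ltr0n bin_gt0 -ltnS.
have H : (\sum_(s : nlift E n) type_count s k)%N%:R * \prod_e 'C(n, k e)%:R
    <= #|[set ab | valid kk ab]%SET|%:R * N%:R :> R.
  rewrite -natr_prod -!natrM ler_nat.
  pose S s ab := valid kk ab && [forall e, (s : nlift E n) e @: (ab e).1 == (ab e).2].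
  apply: (@leq_trans ((\sum_(s : nlift E n) \sum_(ab | S s ab) 1) * \prod_e 'C(n, k e))).
    rewrite leq_mul2r; apply/orP; right; apply: leq_sum => s _; rewrite sum1_card.
    rewrite /type_count -(@card_in_imset _ _ (ab_of s)); last first.
      move=> M M' _ _ /ffunP H; apply/setP => -[e i]; have := H e; rewrite !ffunE.
      by case=> /setP/(_ i); rewrite !inE.
    apply: subset_leq_card; apply/fintype.subsetP => ab /imsetP[M]; rewrite inE => /andP[mM /eqP Mk] ->.
    have := ab_of_valid mM; rewrite Mk => vk; rewrite unfold_in /S vk /=; apply/forallP => e; by rewrite ffunE.
  rewrite (exchange_big_dep (valid kk)) /=; last by move=> s ab _ /andP[].
  rewrite big_distrl /= -sum_nat_const [leqRHS](eq_bigl (valid kk)); last by move=> ab; rewrite inE.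
  apply: leq_sum => ab vk; apply: leq_trans (image_bound vk).
  rewrite leq_mul2r; apply/orP; right; rewrite sum1_card; apply: subset_leq_card.
  by apply/fintype.subsetP => s; rewrite unfold_in inE /S vk.
rewrite -(ler_pM2r C0); apply: le_trans H _.
rewrite mulrC -!mulrA ler_wpM2l ?ler0n //.
apply: le_trans valid_bound _.
have B : expR (- (n%:R * \sum_e (xlnx (x e) + xlnx (1 - x e)))) <=
    n.+1%:R ^+ #|E| * \prod_e 'C(n, k e)%:R :> R.
  rewrite -prodr_const -big_split /= mulr_sumr -sumrN expR_sum.
  rewrite [leRHS](eq_bigl xpredT) //; apply: ler_prod => e _; rewrite expR_ge0 /=.
  by apply: binomial_entropy => //; rewrite -ltnS.
rewrite mulrCA; apply: le_trans (ler_wpM2l (expR_ge0 _) B).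
rewrite -expRD ler_expR /bethe big_split /= (sum_incident (fun=> fun e => xlnx (x e)) Hl).
rewrite !big_split /= sumrN.
set A := \sum_i _; set B1 := \sum_i _; set C1 := \sum_i _; lra.
Qed.
End FirstMoment.

(** * Typical lifts *)

Section BorelCantelli.
Variables (R : realType) (E : finType).
Variables (d : measure_display) (Omega : measurableType d) (P : probability Omega R).
Variable L : forall n : nat, Omega -> nlift E n.
Hypothesis Lmeas : forall (n : nat) (l : nlift E n), measurable (L n @^-1` [set l]).
Hypothesis Lunif : forall (n : nat) (l : nlift E n),
     P (L n @^-1` [set l]) = ((#|{: nlift E n}|%:R)^-1 : R)%:E.

Let N n : R := #|{: nlift E n}|%:R.

Let N_gt0 n : 0 < N n.
Proof. by rewrite ltr0n; apply/card_gt0P; exists [ffun=> 1%g]. Qed.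

Let event n (B : {set nlift E n}) : set Omega := [set w | L n w \in B].

Let event_seq n (s : seq (nlift E n)) : measurable [set w | L n w \in s] /\
  (P [set w | L n w \in s] <= ((size s)%:R / N n)%:E)%E.
Proof.
elim: s => [|l s [mS PS]].
  have -> : [set w | L n w \in [::]] = set0 by apply/seteqP; split.
  by split; [exact: measurable0|rewrite measure0 mul0r].
have -> : [set w | L n w \in l :: s] = L n @^-1` [set l] `|` [set w | L n w \in s].
  apply/seteqP; split => w /=; rewrite inE; first by case/orP => [/eqP|]; [left|right].
  by case=> [->|->]; rewrite ?eqxx ?orbT.
split; first exact: measurableU.
apply: (le_trans (measureU2 _ (Lmeas l) mS)) => //.
rewrite /= -natr1 mulrDl mul1r addrC EFinD; apply: leeD => //.
by have := Lunif l => /= ->.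
Qed.

Let measurable_event n (B : {set nlift E n}) : measurable (event B).
Proof.
have [mB _] := event_seq (enum B); apply: (eq_rect _ measurable mB).
by apply/seteqP; split => w /=; rewrite /event /= mem_enum.
Qed.

Let prob_event n (B : {set nlift E n}) : (P (event B) <= (#|B|%:R / N n)%:E)%E.
Proof.
have [_] := event_seq (enum B); rewrite -cardE; apply: le_trans.
rewrite le_eqVlt; apply/orP; left; apply/eqP; congr (P _).
by apply/seteqP; split => w /=; rewrite /event /= mem_enum.
Qed.

Lemma borel_cantelli_lift (B : forall n, {set nlift E n}) (C : R) (N0 : nat) :
  (forall n, (N0 <= n)%N -> #|B n|%:R * n%:R ^+ 2 <= C * N n) ->
  {ae P, forall w, \forall n \near \oo, L n w \notin B n}.
Proof.
move=> HB.
have C0 : 0 <= C.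
  rewrite -(pmulr_lge0 _ (N_gt0 N0)).
  by apply: le_trans (HB N0 (leqnn _)); rewrite mulr_ge0 ?exprn_ge0.
(* The majorant [u] telescopes. The factor 6 comes from [(k+1)(k+2) <= 6 k^2] for [k >= 1]; the
   second summand makes [u k >= 1] for [k <= N0], where nothing is known. *)
pose C' := C * 6 + (N0.+1 * N0.+2)%N%:R.
have C'0 : 0 <= C' by rewrite addr_ge0 // mulr_ge0.
pose u k : R := C' * (k.+1%:R^-1 - k.+2%:R^-1).
have uE k : u k = C' / (k.+1%:R * k.+2%:R).
  rewrite /u; congr (_ * _); rewrite -[k.+2%:R]natr1.
  have : (0 : R) < k.+1%:R by rewrite ltr0n.
  move: (k.+1%:R) => a a0; field; apply/andP; split; rewrite gt_eqF //; lra.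
have Pu k : (P (event (B k)) <= (u k)%:E)%E.
  have D0 : (0 : R) < k.+1%:R * k.+2%:R by rewrite mulr_gt0.
  have [kN|Nk] := ltnP k N0.+1.
    apply: (@le_trans _ _ 1%E); first exact: probability_le1.
    rewrite lee_fin uE ler_pdivlMr // mul1r /C' -natrM.
    apply: (@le_trans _ _ (N0.+1 * N0.+2)%N%:R); first by rewrite ler_nat leq_mul.
    by rewrite lerDr mulr_ge0.
  apply: le_trans (prob_event _) _; rewrite lee_fin uE.
  have k0 : (0 : R) < k%:R by rewrite ltr0n; apply: leq_trans Nk.
  have k1 : (1 : R) <= k%:R by rewrite ler1n; apply: leq_trans Nk.
  rewrite ler_pdivrMr // mulrAC ler_pdivlMr //.
  apply: (@le_trans _ _ (#|B k|%:R * (6 * k%:R ^+ 2))).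
    rewrite ler_wpM2l // -[k.+2%:R]natr1 -natr1; nra.
  rewrite mulrCA; apply: (@le_trans _ _ (6 * (C * N k))); first by rewrite ler_wpM2l // HB // ltnW.
  rewrite mulrA ler_wpM2r ?(ltW (N_gt0 k)) // /C' mulrC lerDl //.
have sum_fin : (\sum_(n <oo) P (event (B n)) < +oo)%E.
  apply: (@le_lt_trans _ _ C'%:E); last exact: ltry.
  apply: lime_le; first by apply: is_cvg_nneseries => n _ _; exact: measure_ge0.
  apply: nearW => n.
  apply: (@le_trans _ _ (\sum_(0 <= k < n) (u k)%:E)%E); first by apply: lee_sum => k _; exact: Pu.
  rewrite sumEFin lee_fin -mulr_sumr -[leRHS]mulr1 ler_wpM2l //.
  rewrite (eq_big_nat _ _ (F2 := fun k => - (k.+2%:R^-1) - (- (k.+1%:R^-1) : R))); last first.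
    by move=> k _; rewrite opprK addrC.
  by rewrite telescope_sumr // opprK invr1 gerDr oppr_le0 invr_ge0.
exists (lim_sup_set (fun n => event (B n))); split.
- by apply: bigcap_measurable => // k _; apply: bigcup_measurable => j _.
- exact: lim_sup_set_cvg0.
- move=> w /= nw n _; apply: contrapT => H; apply: nw.
  exists n => // m /= nm; apply/negP => wB; apply: H; exists m => //.
Qed.
End BorelCantelli.

Section Typical.
Variables (R : realType) (V E : finType) (ends : E -> V * V).
Hypothesis Hl : loopless ends.

(** The exponent adds [#|E|] lost in the first moment, [#|E|] for the union over all types, and 2
    for summability in Borel-Cantelli. *)
Definition type_bound n (k : {ffun E -> 'I_n.+1}) : R :=
  n.+1%:R ^+ (2 * #|E| + 2) * expR (n%:R * bethe ends (fun e => (k e)%:R / n%:R)).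

(** Free of [z], so one null set serves every [z]. The second clause says that the number of cycle
    pairs is [o(n^2)], with an integer [j] so that only countably many events are intersected. *)
Definition typical (l : forall n, nlift E n) :=
  (\forall n \near \oo, forall k, (type_count ends (l n) k)%:R <= type_bound k) /\
  (forall m j, odd m -> \forall n \near \oo,
     (j.+1 ^ 2 * #|cycle_pairs (lift_ends ends (l n)) m| < n * n)%N).

Let N n : R := #|{: nlift E n}|%:R.

Lemma markov_count (T : finType) (f : T -> R) (t : R) : (forall i, 0 <= f i) ->
  #|[set i | t <= f i]%SET|%:R * t <= \sum_i f i.
Proof.
move=> f0; rewrite (bigID (fun i => t <= f i)) /= -[leLHS]addr0 lerD ?sumr_ge0 //.
rewrite mulr_natl -sumr_const [leLHS](eq_bigl (fun i => t <= f i)) => [|i]; last by rewrite inE.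
exact: ler_sum.
Qed.

Let bad1 n := [set s : nlift E n | ~~ [forall k, (type_count ends s k)%:R <= type_bound k]]%SET.

Let type_bound_gt0 n (k : {ffun E -> 'I_n.+1}) : 0 < type_bound k.
Proof. by rewrite mulr_gt0 ?expR_gt0 // exprn_gt0. Qed.

Let bad1_card n : (0 < n)%N -> #|bad1 n|%:R * n%:R ^+ 2 <= 1 * N n.
Proof.
move=> n0; rewrite mul1r.
pose bk (k : {ffun E -> 'I_n.+1}) := [set s : nlift E n | type_bound k <= (type_count ends s k)%:R]%SET.
have U : (#|bad1 n| <= \sum_k #|bk k|)%N.
  rewrite -sum1_card big_mkcond /=.
  apply: (@leq_trans (\sum_(s : nlift E n) \sum_k (s \in bk k))%N).
    apply: leq_sum => s _; rewrite inE; case: ifP => // /forallPn[k].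
    by rewrite -ltNge => Hk; rewrite (bigD1 k) //= inE (ltW Hk).
  rewrite exchange_big /=; apply: leq_sum => k _.
  by rewrite -sum1_card [leqRHS]big_mkcond /=; apply: leq_sum => s _; case: (_ \in _).
have P0 : (0 : R) < n.+1%:R ^+ #|E| by rewrite exprn_gt0.
have D k : #|bk k|%:R * n.+1%:R ^+ (#|E| + 2) <= N n.
  have := @markov_count _ (fun s : nlift E n => (type_count ends s k)%:R) (type_bound k) (fun=> ler0n _ _).
  rewrite -natr_sum -/(bk k) => M.
  have [xFM|nFM] := pselect (FM (R := R) ends (fun e => (k e)%:R / n%:R)).
    have := le_trans M (first_moment Hl n0 xFM).
    have -> : type_bound k = n.+1%:R ^+ (#|E| + 2) * n.+1%:R ^+ #|E| *
        expR (n%:R * bethe ends (fun e => (k e)%:R / n%:R)).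
      by rewrite -exprD /type_bound; congr (_ ^+ _ * _); lia.
    by rewrite !mulrA ler_pM2r ?expR_gt0 // (ler_pM2r P0).
  suff -> : bk k = finset.set0 by rewrite cards0 mul0r.
  apply/setP => s; rewrite !inE; apply/negbTE; rewrite -ltNge.
  suff -> : type_count ends s k = 0%N by [].
  apply/eqP; rewrite cards_eq0; apply/eqP/setP => M'; rewrite !inE.
  apply/negP => /andP[mM /eqP Mk]; apply: nFM; rewrite -Mk; exact: (matching_FM _ n0 mM).
rewrite -(ler_pM2r P0); apply: (@le_trans _ _ ((\sum_k #|bk k|%:R) * n.+1%:R ^+ (#|E| + 2))).
  rewrite -mulrA; apply: ler_pM => //; rewrite ?mulr_ge0 ?exprn_ge0 //.
    by rewrite -natr_sum ler_nat.
  by rewrite [leRHS]exprD mulrC ler_wpM2l ?exprn_ge0 // lerXn2r ?nnegrE // ler_nat.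
rewrite mulr_suml; apply: (@le_trans _ _ (\sum_(k : {ffun E -> 'I_n.+1}) N n)); first exact: ler_sum.
by rewrite sumr_const card_ffun card_ord -[leLHS]mulr_natr natrX.
Qed.

Let bad2 m j n := [set s : nlift E n | (n * n <= j.+1 ^ 2 * #|cycle_pairs (lift_ends ends s) m|)%N]%SET.

Let bad2_card m j n : odd m -> (4 * m < n)%N ->
  #|bad2 m j n|%:R * n%:R ^+ 2 <= (j.+1 ^ 2 * (4 * #|E|) ^ (2 * m))%N%:R * N n.
Proof.
move=> om mn.
have := @cycle_moment _ _ ends n m om; set S := (\sum_s _)%N => CM.
have S1 : (S <= (4 * #|E|) ^ (2 * m) * #|{: nlift E n}|)%N.
  have D0 : (0 < (n - 2 * m) ^ (2 * m))%N by rewrite expn_gt0; apply/orP; left; lia.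
  rewrite -(leq_pmul2r D0); apply: leq_trans CM _; rewrite [leqRHS]mulnAC leq_mul2r; apply/orP; right.
  (* [4 m < n] gives [n <= 2 (n - 2 m)], hence the 4 in place of the 2. *)
  rewrite -expnMn leq_exp2r; last by move: om; case: (m).
  nia.
have M := @markov_count _ (fun s : nlift E n => (j.+1 ^ 2 * #|cycle_pairs (lift_ends ends s) m|)%N%:R) (n * n)%N%:R (fun=> ler0n _ _).
rewrite expr2 -natrM; have -> : bad2 m j n = [set s : nlift E n | (n * n)%N%:R <=
    (j.+1 ^ 2 * #|cycle_pairs (lift_ends ends s) m|)%N%:R :> R]%SET.
  by apply/setP => s; rewrite !inE ler_nat.
apply: le_trans M _; rewrite -natr_sum -big_distrr /= -natrM ler_nat -mulnA leq_mul2l.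
by apply/orP; right.
Qed.

Variables (d : measure_display) (Omega : measurableType d) (P : probability Omega R).
Variable L : forall n : nat, Omega -> nlift E n.
Hypothesis Lmeas : forall (n : nat) (l : nlift E n), measurable (L n @^-1` [set l]).
Hypothesis Lunif : forall (n : nat) (l : nlift E n),
     P (L n @^-1` [set l]) = ((#|{: nlift E n}|%:R)^-1 : R)%:E.

Lemma typical_ae : {ae P, forall w, typical (fun n => L n w)}.
Proof.
have A1 : {ae P, forall w, \forall n \near \oo, L n w \notin bad1 n}.
  by apply: (borel_cantelli_lift Lmeas Lunif (N0 := 1%N)) => n n1; exact: bad1_card.
have A2 : {ae P, forall w, forall m j, odd m -> \forall n \near \oo, L n w \notin bad2 m j n}.
  apply: ae_foralln => m; apply: ae_foralln => j.
  have [om|em] := boolP (odd m); last by apply: aeW => w.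
  have := borel_cantelli_lift Lmeas Lunif (N0 := (4 * m).+1) (fun n Hn => bad2_card j om Hn).
  by apply: filterS => w Hw _.
apply: filterS2 A1 A2 => w A1 A2; split.
  by apply: filterS A1 => n; rewrite inE negbK => /forallP.
by move=> m j om; apply: filterS (A2 m j om) => n; rewrite inE -ltnNge.
Qed.
End Typical.

(** * Compactness *)

Section Compactness.
Variable R : realType.

(** Along an ultrafilter finer than [\oo] all bounded sequences converge at once, so limits of
    finitely many coordinates need no successive subsequences. *)
Lemma ultra_limit : exists U : set_system nat, [/\ ProperFilter U, \oo `<=` U &
  forall (u : nat -> R) (a b : R), (forall n, a <= u n <= b) ->
    exists l : R, u n @[n --> U] --> l].
Proof.
have [U [uU sU]] := ultraFilterLemma (@eventually_filter).
exists U; split => //; first exact: ultra_proper.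
move=> u a b uab.
have PF : ProperFilter (u @ U) by apply: fmap_proper_filter; exact: ultra_proper.
have uA : U (u @^-1` `[a, b]%classic).
  apply: (@filterS _ U _ setT); last exact: filterT.
  by move=> n _ /=; rewrite in_itv /=.
have [l [_ ul]] := segment_compact PF uA.
exists l => A Al; case: (in_ultra_setVsetC (u @^-1` A) uU) => // nA.
by have [x []] := ul (~` A) A nA Al.
Qed.

Lemma cvg_ge (T : topologicalType) (F : set_system T) (PF : ProperFilter F) (f : T -> R) (l c : R) :
  f t @[t --> F] --> l -> (forall t, c <= f t) -> c <= l.
Proof.
move=> fl cf; have cc : (fun=> c) t @[t --> F] --> c by exact: cvg_cst.
by apply: (ler_cvg_to cc fl); exact: nearW.
Qed.

Lemma cvg_le (T : topologicalType) (F : set_system T) (PF : ProperFilter F) (f : T -> R) (l c : R) :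
  f t @[t --> F] --> l -> (forall t, f t <= c) -> l <= c.
Proof.
move=> fl cf; have cc : (fun=> c) t @[t --> F] --> c by exact: cvg_cst.
by apply: (ler_cvg_to fl cc); exact: nearW.
Qed.

Variables (V E : finType) (ends : E -> V * V).

Lemma FM_compact (xs : nat -> E -> R) : (forall n, FM ends (xs n)) ->
  exists U : set_system nat, [/\ ProperFilter U, \oo `<=` U &
    exists2 y, FM ends y & forall e, xs n e @[n --> U] --> y e].
Proof.
move=> xFM; have [U [PU sU Ulim]] := ultra_limit; exists U; split => //.
have /choice[y xy] : forall e, exists l : R, xs n e @[n --> U] --> l.
  by move=> e; apply: (Ulim _ 0 1) => n; exact: FM_le1.
exists y => //; split => [e|v].
  by apply: (cvg_ge _ (xy e)) => n; have [] := xFM n.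
have vy : vsum ends (xs n) v @[n --> U] --> vsum ends y v by apply: cvg_vsum.
by apply: (cvg_le _ vy) => n; have [] := xFM n.
Qed.

Lemma bethe_bound (x : E -> R) : FM ends x ->
  - (#|E| + #|V|)%:R <= bethe ends x <= (#|E| + #|V|)%:R.
Proof.
move=> xFM; have [x0 x1] := xFM.
have He e : -1 <= - xlnx (x e) + xlnx (1 - x e) <= 1.
  have /andP[h0 h1] := FM_le1 e xFM.
  have /andP[a1 a2] : -1 <= xlnx (x e) <= 0 by apply: xlnx_itv; rewrite h0.
  have /andP[b1 b2] : -1 <= xlnx (1 - x e) <= 0 by apply: xlnx_itv; apply/andP; split; lra.
  by apply/andP; split; lra.
have Hv v : -1 <= xlnx (1 - vsum ends x v) <= 0.
  have h0 : 0 <= vsum ends x v by apply: sumr_ge0 => e _.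
  have := x1 v => h1; apply: xlnx_itv; apply/andP; split; lra.
rewrite /bethe natrD; set A := \sum_e _; set B := \sum_v _.
have A1 : - #|E|%:R <= A.
  rewrite -mulN1r mulr_natr -sumr_const /A; apply: ler_sum => e _; by case/andP: (He e).
have A2 : A <= #|E|%:R by rewrite -sumr_const; apply: ler_sum => e _; case/andP: (He e).
have B1 : - #|V|%:R <= B.
  rewrite -mulN1r mulr_natr -sumr_const /B; apply: ler_sum => e _; by case/andP: (Hv e).
have B2 : B <= 0 by rewrite -oppr_ge0 -sumrN sumr_ge0 // => v _; rewrite oppr_ge0; case/andP: (Hv v).
have V0 : 0 <= #|V|%:R :> R by [].
by apply/andP; split; lra.
Qed.

Lemma edge_sum_bound (x : E -> R) : FM ends x -> 0 <= edge_sum x <= #|E|%:R.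
Proof.
move=> xFM; rewrite sumr_ge0 => [|e _]; last by case/andP: (FM_le1 e xFM).
by rewrite -sumr_const; apply: ler_sum => e _; case/andP: (FM_le1 e xFM).
Qed.

Lemma FM0 : FM (R := R) ends (fun=> 0).
Proof. by split=> // v; rewrite /vsum big1. Qed.

Definition free_energy (z : R) : R := sup [set edge_sum x * ln z + bethe ends x | x in FM (R := R) ends].

Lemma le_free_energy z x : FM ends x -> edge_sum x * ln z + bethe ends x <= free_energy z.
Proof.
move=> xFM; apply: ub_le_sup; last by exists x.
exists (#|E|%:R * `|ln z| + (#|E| + #|V|)%:R) => _ [y yFM <-].
have /andP[_ b] := bethe_bound yFM; rewrite lerD //.
have /andP[y0 y1] := edge_sum_bound yFM.
apply: le_trans (ler_norm _) _; rewrite normrM ler_wpM2r // ger0_norm //.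
Qed.

Lemma free_energy_approx z e : 0 < e ->
  exists2 x, FM ends x & free_energy z - e < edge_sum x * ln z + bethe ends x.
Proof.
move=> e0; have [|_ [x xFM <-] H] := @sup_adherent _ [set edge_sum x * ln z + bethe ends x | x in FM (R := R) ends] e e0.
  split; first by exists (edge_sum (fun _ : E => 0) * ln z + bethe ends (fun _ => 0)); exists (fun=> 0) => //; exact: FM0.
  by exists (free_energy z) => _ [x xFM <-]; exact: le_free_energy.
by exists x.
Qed.

Lemma le_nu_star x : FM ends x -> edge_sum x <= nu_star ends R.
Proof.
move=> xFM; apply: ub_le_sup; last by exists x.
by exists #|E|%:R => _ [y /edge_sum_bound/andP[_ ?] <-].
Qed.

Lemma nu_star_approx e : 0 < e ->
  exists2 x, FM (R := R) ends x & nu_star ends R - e < edge_sum x.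
Proof.
move=> e0; have [|_ [x xFM <-] H] := @sup_adherent _ [set edge_sum x | x in FM (R := R) ends] e e0.
  split; first by exists (edge_sum (fun _ : E => 0)); exists (fun=> 0) => //; exact: FM0.
  by exists (nu_star ends R) => _ [x xFM <-]; exact: le_nu_star.
by exists x.
Qed.

Lemma FPM_cluster (xs : nat -> E -> R) (c : R) :
  (forall n, [/\ FM ends (xs n), nu_star ends R - harmonic n <= edge_sum (xs n) & c <= bethe ends (xs n)]) ->
  exists2 y, FPM ends y & c <= bethe ends y.
Proof.
move=> H; have [|U [PU sU [y yFM xy]]] := @FM_compact xs; first by move=> n; case: (H n).
have by_ : bethe ends (xs n) @[n --> U] --> bethe ends y by apply: cvg_bethe.
have ey : edge_sum (xs n) @[n --> U] --> edge_sum y by apply: cvg_edge_sum.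
exists y; last by apply: (cvg_ge _ by_) => n; case: (H n).
split=> //; apply/eqP; rewrite eq_le le_nu_star //=.
have hU : nu_star ends R - harmonic n @[n --> U] --> nu_star ends R - 0.
  apply: cvgB; first exact: cvg_cst.
  move=> A /(@cvg_harmonic R) HA; exact: sU.
rewrite subr0 in hU.
by apply: (ler_cvg_to hU ey); apply: nearW => n; case: (H n).
Qed.

Lemma FPM_nonempty : exists x, FPM (R := R) ends x.
Proof.
have h0 n : (0 : R) < harmonic n by rewrite invr_gt0 ltr0n.
have /choice[xs Hx] : forall n, exists x, FM (R := R) ends x /\ nu_star ends R - harmonic n < edge_sum x.
  by move=> n; have [x ? ?] := nu_star_approx (h0 n); exists x.
have [|y yF _] := @FPM_cluster xs (- (#|E| + #|V|)%:R); last by exists y.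
by move=> n; have [xF xn] := Hx n; split=> //; [exact: ltW|case/andP: (bethe_bound xF)].
Qed.

Definition bethe_FPM : R := sup [set bethe ends x | x in FPM (R := R) ends].

Lemma le_bethe_FPM x : FPM ends x -> bethe ends x <= bethe_FPM.
Proof.
move=> xFM; apply: ub_le_sup; last by exists x.
by exists (#|E| + #|V|)%:R => _ [y [/bethe_bound/andP[_ ?] _] <-].
Qed.

(** Needed because maximum matchings of a lift have density close to [nu_star] but perhaps not equal
    to it. A sequence of counterexamples would accumulate at a point of [FPM] whose entropy exceeds
    the supremum. *)
Lemma bethe_near_FPM e : 0 < e -> exists2 dl, 0 < dl &
  forall x, FM ends x -> nu_star ends R - dl <= edge_sum x -> bethe ends x <= bethe_FPM + e.
Proof.
move=> e0; apply: contrapT => H.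
have h0 n : (0 : R) < harmonic n by rewrite invr_gt0 ltr0n.
have /choice[xs Hx] : forall n, exists x, [/\ FM ends x, nu_star ends R - harmonic n <= edge_sum x
    & bethe_FPM + e <= bethe ends x].
  move=> n; apply: contrapT => H'; apply: H; exists (harmonic n) => // x xF xn.
  by rewrite leNgt; apply/negP => /ltW ?; apply: H'; exists x.
have [y yF] := FPM_cluster Hx; have := le_bethe_FPM yF; lra.
Qed.
End Compactness.

(** * Limits along typical lifts *)

Section MatchingNumber.
Variables (V E : finType) (ends : E -> V * V).

Lemma le_match_num M : is_matching ends M -> (#|M| <= match_num ends)%N.
Proof. by move=> mM; apply: (leq_bigmax_cond (F := fun M : {set E} => #|M|)). Qed.

Lemma match_num_ex : exists2 M, is_matching ends M & #|M| = match_num ends.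
Proof.
have [|M mM EM] := @eq_bigmax_cond _ (is_matching ends) (fun M : {set E} => #|M|).
  by apply/card_gt0P; exists finset.set0; exact: is_matching0.
by exists M.
Qed.

Lemma nmatch_match_num_gt0 : (0 < nmatch ends (match_num ends))%N.
Proof.
by have [M mM EM] := match_num_ex; apply/card_gt0P; exists M; rewrite inE mM EM eqxx.
Qed.

Lemma match_poly_gt0 (R : realType) (z : R) : 0 < z -> 0 < match_poly ends z.
Proof.
move=> z0; rewrite match_poly_sum (bigD1 finset.set0) ?is_matching0 //= cards0 expr0.
by rewrite ltr_pwDl // sumr_ge0 // => M _; rewrite exprn_ge0 // ltW.
Qed.

Lemma match_poly_le (R : realType) (z : R) : 1 <= z ->
  match_poly ends z <= 2 ^+ #|E| * z ^+ match_num ends.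
Proof.
move=> z1; rewrite match_poly_sum.
apply: (@le_trans _ _ (\sum_(M : {set E}) z ^+ match_num ends)).
  rewrite big_mkcond; apply: ler_sum => M _; case: ifP => [mM|_].
    by rewrite ler_weXn2l // le_match_num.
  by rewrite exprn_ge0 // (le_trans ler01).
rewrite sumr_const -[leLHS]mulr_natl (_ : #|_| = 2 ^ #|E|)%N ?natrX //.
by rewrite -(cardsT E) -card_powerset; apply: eq_card => X; rewrite powersetE finset.subsetT.
Qed.
End MatchingNumber.

Section Asymptotics.
Variable R : realType.

(** [ln (n+1) / (n+1)] is [- xlnx (1 / (n+1))], which tends to 0 by continuity of [xlnx]. *)
Lemma ln_near_linear (e : R) : 0 < e -> \forall n \near \oo, ln n.+1%:R <= e * n%:R :> R.
Proof.
move=> e0; have h0 : harmonic n @[n --> \oo] --> (0 : R) by exact: cvg_harmonic.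
have := cvg_xlnx _ h0; rewrite {2}/xlnx eqxx => H.
have e2 : 0 < e / 2 by rewrite divr_gt0.
have {}H : xlnx (harmonic n) @[n --> \oo] --> (0 : R) by apply: H.
move/cvgrPdist_lt: H => /(_ _ e2) H.
near=> n.
have : `|0 - xlnx (harmonic n)| < e / 2 :> R.
  by near: n.
have hn : (harmonic n : R) != 0 by rewrite invr_eq0 pnatr_eq0.
have p0 : (0 : R) < n.+1%:R by rewrite ltr0n.
rewrite /xlnx (negPf hn) sub0r normrN /= lnV ?posrE // mulrN normrN => A.
have {A}A : n.+1%:R^-1 * ln n.+1%:R < e / 2 :> R by apply: le_lt_trans A; exact: ler_norm.
have n1 : (1 : R) <= n%:R by rewrite ler1n; near: n; exists 1%N.
rewrite mulrC ltr_pdivrMr // in A; apply: ltW; apply: lt_le_trans A _.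
have K : 0 <= e * (n%:R - 1) by rewrite mulr_ge0 ?subr_ge0 // ltW.
rewrite -[n.+1%:R]natr1; nra.
Unshelve. all: by end_near. Qed.

(** Chernoff bound: each counted set has [t ^ #|X| >= t ^ r], and the sum over all sets is
    [(1 + t)^#|T| <= exp (t #|T|)]. *)
Lemma card_small_sets (T : finType) (r : nat) (t : R) : 0 < t <= 1 ->
  #|[set X : {set T} | (#|X| <= r)%N]%SET|%:R <= expR (t * #|T|%:R - r%:R * ln t).
Proof.
move=> /andP[t0 t1].
have S : \sum_(X : {set T}) t ^+ #|X| = (1 + t) ^+ #|T|.
  have := @bigA_distr R 0 1 *%R +%R T (fun=> t) (fun=> 1); rewrite /= prodr_const (addrC t) => ->.
  rewrite [RHS](eq_bigl xpredT) => [|X]; last by rewrite inE.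
  apply: eq_bigr => X _; rewrite -prodr_const [RHS](bigID (fun i => i \in X)) /=.
  rewrite [X in _ * X]big1 ?mulr1 => [|i /negPf -> //].
  by apply: eq_bigr => i ->.
have tr : 0 < t ^+ r by rewrite exprn_gt0.
rewrite expRB expRM_natl lnK ?posrE // ler_pdivlMr //.
apply: (@le_trans _ _ (\sum_(X : {set T}) t ^+ #|X|)); last first.
  rewrite S expRM_natr lerXn2r ?nnegrE ?expR_ge0 ?addr_ge0 ?(ltW t0) //.
  exact: expR_ge1Dx.
rewrite mulr_natl -sumr_const big_mkcond; apply: ler_sum => X _; rewrite inE.
case: ifP => [Xr|_]; last by rewrite exprn_ge0 // ltW.
by apply: ler_wiXn2l; rewrite ?(ltW t0).
Qed.

Variables (V E : finType) (ends : E -> V * V).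
Hypothesis Hl : loopless ends.
Variable l : forall n, nlift E n.
Hypothesis typ : typical R ends l.
Local Notation L n := (lift_ends ends (l n)).

Lemma type_countP n (k : {ffun E -> 'I_n.+1}) : (0 < n)%N -> type_count ends (l n) k != 0%N ->
  let x := (fun e => (k e)%:R / n%:R : R) in
  FM ends x /\ edge_sum x = (\sum_e k e)%N%:R / n%:R.
Proof.
move=> n0; rewrite cards_eq0 => /set0Pn[M]; rewrite inE => /andP[mM /eqP <-]; split.
  exact: (matching_FM _ n0 mM).
by rewrite /edge_sum natr_sum mulr_suml.
Qed.

Lemma free_energy_upper (z e : R) : 0 < z -> 0 < e -> \forall n \near \oo,
  ln (match_poly (L n) z) / n%:R <= free_energy ends z + e.
Proof.
(* [2 #|E| + 2] from [type_bound] and [#|E|] more for the number of types. *)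
move=> z0 e0; have C0 : (0 : R) < (3 * #|E| + 2)%N%:R by rewrite ltr0n addn2.
have H := ln_near_linear (divr_gt0 e0 C0); have [T1 _] := typ.
near=> n.
have n0 : (0 < n)%N by near: n; exists 1%N.
have nR : (0 : R) < n%:R by rewrite ltr0n.
have P0 := match_poly_gt0 (L n) z0.
rewrite ler_pdivrMr //.
have lnn : ln n.+1%:R <= e / (3 * #|E| + 2)%N%:R * n%:R :> R by near: n.
have Tn : forall k, (type_count ends (l n) k)%:R <= type_bound R ends k by near: n.
apply: (@le_trans _ _ ((3 * #|E| + 2)%N%:R * ln n.+1%:R + n%:R * free_energy ends z)); last first.
  rewrite mulrDl addrC [n%:R * _]mulrC lerD2l.
  apply: le_trans (ler_wpM2l (ltW C0) lnn) _.
  by rewrite mulrA mulrCA mulfV ?gt_eqF // mulr1.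
rewrite -ler_expR lnK ?posrE // expRD expRM_natl lnK ?posrE ?ltr0n //.
rewrite match_poly_types.
apply: (@le_trans _ _ (\sum_(k : {ffun E -> 'I_n.+1})
   n.+1%:R ^+ (2 * #|E| + 2) * expR (n%:R * free_energy ends z))).
  apply: ler_sum => k _; have [->|tc] := eqVneq (type_count ends (l n) k) 0%N.
    by rewrite mul0r mulr_ge0 ?expR_ge0 ?exprn_ge0.
  have [xFM xk] := type_countP n0 tc.
  have := le_free_energy z xFM; rewrite xk => F.
  have zE : z ^+ (\sum_e k e)%N = expR ((\sum_e k e)%N%:R * ln z).
    by rewrite expRM_natl lnK ?posrE.
  apply: le_trans (ler_wpM2r _ (Tn k)) _; first by rewrite exprn_ge0 // ltW.
  rewrite /type_bound zE -mulrA -expRD ler_wpM2l ?exprn_ge0 // ler_expR.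
  apply: le_trans (ler_wpM2l (ltW nR) F).
  by rewrite le_eqVlt; apply/orP; left; apply/eqP; field; rewrite gt_eqF.
rewrite sumr_const card_ffun card_ord -[leLHS]mulr_natl natrX mulrA -exprD.
by rewrite (_ : #|E| + (2 * #|E| + 2) = 3 * #|E| + 2)%N //; lia.
Unshelve. all: by end_near. Qed.

Lemma near_cycles (b m0 : nat) : (0 < b)%N -> \forall n \near \oo,
  forall m, (m < m0)%N -> odd m ->
    (#|cycle_pairs (L n) m| < (n %/ b).+1 * (n %/ b).+1)%N.
Proof.
move=> b0; have [_ T2] := typ; elim: m0 => [|m0 IH]; first by apply: nearW => n m.
have [om|em] := boolP (odd m0); last first.
  apply: filterS IH => n IH m; rewrite ltnS leq_eqVlt => /orP[/eqP ->|]; last exact: IH.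
  by rewrite (negPf em).
apply: filterS2 IH (T2 m0 b.-1 om) => n IH H m.
rewrite ltnS leq_eqVlt => /orP[/eqP ->|] ; last exact: IH.
move=> _; move: H; rewrite prednK // => H.
have nb : (n < b * (n %/ b).+1)%N by rewrite mulnC ltn_ceil.
rewrite ltnNge; apply/negP => G; nia.
Qed.

Lemma free_energy_lower (z e : R) (x : E -> R) : 0 < z -> 0 < e -> FM ends x -> \forall n \near \oo,
  edge_sum x * ln z + bethe ends x - e <= ln (match_poly (L n) z) / n%:R.
Proof.
move=> z0 e0 xFM.
(* The estimate is for twice the logarithm, so two losses of [e n] are allowed: one is [2 #|E| n t]
   from [card_small_sets], the other [r (ln mx - ln t)], made small by a large [b]. *)
pose t : R := e / (e + 2 * #|E|%:R).
have E0 : (0 : R) <= #|E|%:R by [].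
have t0 : 0 < t by rewrite divr_gt0 //; lra.
have t1 : t <= 1 by rewrite ler_pdivrMr ?mul1r; lra.
have tE : #|E|%:R * t <= e / 2 by rewrite /t mulrA ler_pdivrMr; nra.
pose mx := Num.max 1 z.
have mx1 : 1 <= mx by rewrite le_max lexx.
have lnmx : 0 <= ln mx by exact: ln_ge0.
have lnt : ln t <= 0 by exact: ln_le0.
pose v : R := (#|V| + 2)%N%:R.
have v0 : 0 <= v by [].
pose b := (Num.trunc (v * (ln mx - ln t) / e)).+1.
have bP : v * (ln mx - ln t) / e <= b%:R by rewrite ltW // truncnS_gt.
have b0 : (0 < b)%N by [].
have bR : (0 : R) < b%:R by rewrite ltr0n.
have bb0 : (0 < b * b)%N by rewrite muln_gt0.
have NC := near_cycles b bb0.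
near=> n.
have n0 : (0 < n)%N by near: n; exists 1%N.
have nbb : (b * b <= n)%N by near: n; exists (b * b)%N.
have nR : (0 : R) < n%:R by rewrite ltr0n.
have NC1 : forall m, (m < b)%N -> odd m ->
    (#|cycle_pairs (L n) m| < (n %/ (b * b)).+1 * (n %/ (b * b)).+1)%N by near: n.
have Hln : loopless (L n) by exact: loopless_lift.
set r := (b * (n %/ (b * b)).+1 + #|{: V * 'I_n}| %/ b)%N.
(* Cycles count as short below length [b], with at most [n / b^2 + 1] of each length. Times [b], the
   two summands give at most [n] each once [b^2 <= n], and the long cycles give [#|V| n]: this is
   [v]. *)
have rb : r%:R * b%:R <= v * n%:R :> R.
  rewrite -!natrM ler_nat /r mulnDl.
  have h1 := leq_trunc_div n (b * b); have h2 := leq_trunc_div #|{: V * 'I_n}| b.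
  rewrite mulnAC mulnS [(b * b * _)%N]mulnC mulnDl mul2n -addnn addnC.
  apply: leq_add; first by apply: leq_trans h2 _; rewrite card_prod card_ord.
  by rewrite addnC; apply: leq_add.
have := double_cover_le (ends := L n) Hln z0 (fun M mM => odd_cut mM b0 NC1).
rewrite -/r -/mx => D.
have := bethe_lower_poly (double_cover_bipartite (L n)) z0 (double_cover_FM Hln (lift_FM Hl (l n) xFM)).
rewrite double_cover_edge_sum double_cover_bethe // lift_edge_sum lift_bethe // => B.
have P0 := match_poly_gt0 (L n) z0.
have tt : 0 < t <= 1 by rewrite t0.
have {}D := le_trans B (le_trans D (ler_wpM2r _ (ler_wpM2r _ (card_small_sets _ r tt)))).
have mx0 : 0 < mx by apply: lt_le_trans mx1.
have {}D : expR (2 * (n%:R * edge_sum x) * ln z + 2 * (n%:R * bethe ends x)) <=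
  expR (t * #|{: E * 'I_n * bool}|%:R - r%:R * ln t + r%:R * ln mx + ln (match_poly (L n) z) * 2%:R).
  apply: le_trans (D _ _) _; rewrite ?exprn_ge0 ?(ltW mx0) ?(ltW P0) //.
  by rewrite !expRD [expR (ln _ * _)]expRM_natr lnK ?posrE // [expR (r%:R * ln mx)]expRM_natl lnK ?posrE.
rewrite ler_expR !card_prod card_bool card_ord !natrM in D.
rewrite ler_pdivlMr // mulrBl.
have rr : r%:R * (ln mx - ln t) <= e * n%:R.
  rewrite -(ler_pM2r bR) mulrAC; apply: (@le_trans _ _ (v * n%:R * (ln mx - ln t))).
    by rewrite ler_wpM2r // subr_ge0 (le_trans lnt).
  move: bP; rewrite ler_pdivrMr // => /(ler_wpM2r (ltW nR)) bP.
  by rewrite mulrAC; apply: le_trans bP _; rewrite le_eqVlt; apply/orP; left; apply/eqP; ring.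
have := ler_wpM2r (ltW nR) tE => tEn.
lra.
Unshelve. all: by end_near. Qed.
End Asymptotics.

Lemma limn_esup_le_near (R : realType) (u : nat -> \bar R) (c : \bar R) :
  (\forall n \near \oo, (u n <= c)%E) -> (limn_esup u <= c)%E.
Proof.
move=> uc; apply: (@le_trans _ _ (ereal_sup (u @` [set n | (u n <= c)%E]))).
  by apply: ereal_inf_lbound; exists [set n | (u n <= c)%E].
by apply: ge_ereal_sup => _ [n un <-].
Qed.

Section Limits.
Variables (R : realType) (V E : finType) (ends : E -> V * V).
Hypothesis Hl : loopless ends.
Variable l : forall n, nlift E n.
Hypothesis typ : typical R ends l.
Local Notation L n := (lift_ends ends (l n)).
Local Notation nu n := (match_num (L n)).

Lemma free_energy_cvg (z : R) : 0 < z ->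
  ln (match_poly (L n) z) / n%:R @[n --> \oo] --> free_energy ends z.
Proof.
move=> z0; apply/cvgrPdist_le => e e0.
have e2 : 0 < e / 2 by rewrite divr_gt0.
have [x xFM xz] := free_energy_approx ends z e2.
have H1 := free_energy_upper typ z0 e0; have H2 := free_energy_lower Hl typ z0 e2 xFM.
near=> n.
have h1 : ln (match_poly (L n) z) / n%:R <= free_energy ends z + e by near: n.
have h2 : edge_sum x * ln z + bethe ends x - e / 2 <= ln (match_poly (L n) z) / n%:R by near: n.
by rewrite ler_norml; apply/andP; split; lra.
Unshelve. all: by end_near. Qed.

Lemma match_num_le n (s : nlift E n) : (0 < n)%N ->
  (match_num (lift_ends ends s))%:R / n%:R <= nu_star ends R.
Proof.
move=> n0; have [M mM <-] := match_num_ex (lift_ends ends s).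
have := le_nu_star (matching_FM R n0 mM); apply: le_trans.
by rewrite /edge_sum -mulr_suml -natr_sum sum_mtype.
Qed.

(** At [z = expR T], [ln P / n] grows in [T] with slope at least [edge_sum x], while [match_poly_le]
    allows slope [nu / n]. [C] bounds all terms without [T], and [T = C / (e / 2)] makes them cost
    only [e / 2] in the slope. *)
Lemma match_num_lower (e : R) : 0 < e -> \forall n \near \oo,
  nu_star ends R - e <= (nu n)%:R / n%:R.
Proof.
move=> e0; have e2 : 0 < e / 2 by rewrite divr_gt0.
have [x xFM xnu] := nu_star_approx ends e2.
have /andP[xB _] := bethe_bound xFM.
set B : R := (#|E| + #|V|)%:R in xB.
have ln2 : 0 <= ln (2 : R) by apply: ln_ge0; rewrite ler1n.
pose C := B + 1 + #|E|%:R * ln (2 : R).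
have C0 : 0 < C by rewrite ltr_pwDl ?mulr_ge0 // ltr_wpDl.
pose T := C / (e / 2).
have T0 : 0 < T by rewrite divr_gt0.
have z0 := expR_gt0 T.
have H := free_energy_lower Hl typ z0 ltr01 xFM.
near=> n.
have n0 : (0 < n)%N by near: n; exists 1%N.
have nR : (0 : R) < n%:R by rewrite ltr0n.
have H1 : edge_sum x * ln (expR T) + bethe ends x - 1 <= ln (match_poly (L n) (expR T)) / n%:R.
  by near: n.
rewrite expRK in H1.
have U : ln (match_poly (L n) (expR T)) / n%:R <= #|E|%:R * ln 2 + (nu n)%:R / n%:R * T.
  rewrite ler_pdivrMr // -ler_expR lnK ?posrE ?match_poly_gt0 //.
  apply: le_trans (match_poly_le _ _) _; first by rewrite -expR0 ler_expR ltW.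
  rewrite -expRM_natl -[2 in leLHS]lnK ?posrE // -expRM_natl -expRD ler_expR card_prod card_ord natrM.
  by rewrite le_eqVlt; apply/orP; left; apply/eqP; field; rewrite gt_eqF.
have H2 := le_trans H1 U.
have CT : C = T * (e / 2) by rewrite /T divfK // gt_eqF.
rewrite -(ler_pM2r T0) mulrBl.
have : (nu_star ends R - e / 2) * T <= edge_sum x * T by rewrite ler_pM2r // ltW.
rewrite /C in CT.
lra.
Unshelve. all: by end_near. Qed.

Lemma match_num_cvg : (nu n)%:R / n%:R @[n --> \oo] --> nu_star ends R.
Proof.
apply/cvgrPdist_le => e e0; have H := match_num_lower e0.
near=> n.
have n0 : (0 < n)%N by near: n; exists 1%N.
have h1 := match_num_le (l n) n0.
have h2 : nu_star ends R - e <= (nu n)%:R / n%:R by near: n.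
by rewrite ler_norml; apply/andP; split; lra.
Unshelve. all: by end_near. Qed.

Lemma max_matchings_upper (e : R) : 0 < e -> \forall n \near \oo,
  ln (nmatch (L n) (nu n))%:R / n%:R <= bethe_FPM R ends + e.
Proof.
move=> e0; have e2 : 0 < e / 2 by rewrite divr_gt0.
have [dl dl0 Hdl] := bethe_near_FPM ends e2.
have C0 : (0 : R) < (3 * #|E| + 2)%N%:R by rewrite ltr0n addn2.
have H := ln_near_linear (divr_gt0 e2 C0); have [T1 _] := typ.
have Hnu := match_num_lower dl0.
near=> n.
have n0 : (0 < n)%N by near: n; exists 1%N.
have nR : (0 : R) < n%:R by rewrite ltr0n.
have lnn : ln n.+1%:R <= e / 2 / (3 * #|E| + 2)%N%:R * n%:R :> R by near: n.
have Tn : forall k, (type_count ends (l n) k)%:R <= type_bound R ends k by near: n.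
have Hnu1 : nu_star ends R - dl <= (nu n)%:R / n%:R by near: n.
set S := bethe_FPM R ends.
rewrite ler_pdivrMr //.
apply: (@le_trans _ _ ((3 * #|E| + 2)%N%:R * ln n.+1%:R + n%:R * (S + e / 2))); last first.
  have : (3 * #|E| + 2)%N%:R * ln n.+1%:R <= e / 2 * n%:R :> R.
    by apply: le_trans (ler_wpM2l (ltW C0) lnn) _; rewrite mulrA mulrCA mulfV ?gt_eqF // mulr1.
  lra.
rewrite -ler_expR lnK ?posrE ?ltr0n ?nmatch_match_num_gt0 // expRD expRM_natl lnK ?posrE ?ltr0n //.
rewrite nmatch_types natr_sum.
apply: (@le_trans _ _ (\sum_(k : {ffun E -> 'I_n.+1})
   n.+1%:R ^+ (2 * #|E| + 2) * expR (n%:R * (S + e / 2)))).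
  rewrite big_mkcond; apply: ler_sum => k _; case: ifP => [/eqP knu|_]; last first.
    by rewrite mulr_ge0 ?expR_ge0 ?exprn_ge0.
  have [->|tc] := eqVneq (type_count ends (l n) k) 0%N.
    by rewrite mulr_ge0 ?expR_ge0 ?exprn_ge0.
  have [xFM xk] := type_countP R n0 tc.
  apply: le_trans (Tn k) _; rewrite /type_bound ler_wpM2l ?exprn_ge0 // ler_expR ler_pM2l //.
  by apply: Hdl => //; rewrite xk knu.
rewrite sumr_const card_ffun card_ord -[leLHS]mulr_natl natrX mulrA -exprD.
by rewrite (_ : #|E| + (2 * #|E| + 2) = 3 * #|E| + 2)%N //; lia.
Unshelve. all: by end_near. Qed.

Lemma max_matchings_limsup :
  (limn_esup (fun n => (ln (nmatch (L n) (nu n))%:R / n%:R)%:E) <= (bethe_FPM R ends)%:E)%E.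
Proof.
apply/lee_addgt0Pr => e e0; rewrite -EFinD; apply: limn_esup_le_near.
by apply: filterS (max_matchings_upper e0) => n; rewrite lee_fin.
Qed.
End Limits.

(** * The bipartite case *)

Lemma le0_linear_bound (R : realType) (c C : R) : (forall T, 0 < T -> c * T <= C) -> c <= 0.
Proof.
move=> H; rewrite leNgt; apply/negP => c0.
have C0 : 0 <= C by apply: le_trans (H 1 ltr01); rewrite mulr1 ltW.
have T0 : 0 < (C + 1) / c by rewrite divr_gt0 // ltr_wpDl.
by have := H _ T0; rewrite mulrC divfK ?gt_eqF //; lra.
Qed.

Section Bipartite.
Variables (R : realType) (V E : finType) (ends : E -> V * V).
Hypothesis bip : bipartite_graph ends.

(** Compares degrees as [z = expR T] tends to infinity in the Bethe bound; integrality follows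
    without duality. *)
Lemma bipartite_match_num_ge (x : E -> R) : FM ends x -> edge_sum x <= (match_num ends)%:R.
Proof.
move=> xFM; rewrite -subr_le0.
apply: (@le0_linear_bound _ _ (#|E|%:R * ln 2 - bethe ends x)) => T T0.
have := le_trans (bethe_lower_poly bip (expR_gt0 T) xFM) (match_poly_le ends _).
rewrite -[X in X <= expR T]expR0 ler_expR (ltW T0) => /(_ isT).
rewrite expRK -expRM_natl -[2 in X in _ <= X * _ -> _]lnK ?posrE // -expRM_natl -expRD ler_expR.
lra.
Qed.

Lemma bipartite_max_matchings (x : E -> R) : FM ends x -> edge_sum x = (match_num ends)%:R ->
  bethe ends x <= ln (nmatch ends (match_num ends))%:R.
Proof.
move=> xFM xnu; set m := nmatch _ _; set nu := match_num ends in xnu *.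
have m0 : (0 : R) < m%:R by rewrite ltr0n nmatch_match_num_gt0.
rewrite -ler_expR lnK ?posrE // -subr_le0.
apply: (@le0_linear_bound _ _ (2 ^+ #|E| - (expR (bethe ends x) - m%:R))) => T T0.
have z1 : 1 <= 1 + T by rewrite lerDl ltW.
have z0 : 0 < 1 + T by lra.
have := bethe_lower_poly bip z0 xFM; rewrite expRD xnu expRM_natl lnK ?posrE // => B.
(* Leading coefficients are compared: a matching that is not maximum is short of the top degree by
   at least one factor [1 + T], and there are at most [2 ^ #|E|] of them. *)
have : match_poly ends (1 + T) * (1 + T) <= (1 + T) ^+ nu * (m%:R * (1 + T) + 2 ^+ #|E|).
  rewrite match_poly_sum (bigID (fun M : {set E} => #|M| == nu)) /= mulrDl [leRHS]mulrDr lerD //.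
    rewrite mulrA ler_wpM2r ?(ltW z0) // mulrC mulr_natl -sumr_const.
    rewrite le_eqVlt; apply/orP; left; apply/eqP.
    by apply: eq_big => M; [rewrite inE|move=> /andP[_ /eqP ->]].
  rewrite mulr_suml; apply: (@le_trans _ _ (\sum_(M : {set E}) (1 + T) ^+ nu)).
    rewrite big_mkcond; apply: ler_sum => M _; case: ifP => [/andP[mM Mnu]|_].
      by rewrite -exprSr ler_weXn2l // ltn_neqAle Mnu le_match_num.
    by rewrite exprn_ge0 // ltW.
  rewrite sumr_const -[leLHS]mulr_natr (_ : #|_| = 2 ^ #|E|)%N ?natrX //.
  by rewrite -(cardsT E) -card_powerset; apply: eq_card => X; rewrite powersetE finset.subsetT.
move=> U; have := le_trans (ler_wpM2r (ltW z0) B) U.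
rewrite -mulrA ler_pM2l ?exprn_gt0 //; lra.
Qed.

Definition indic (M : {set E}) (e : E) : R := (e \in M)%:R.

Lemma edge_sum_indic M : edge_sum (indic M) = #|M|%:R.
Proof.
rewrite /edge_sum -sum1_card natr_sum [RHS]big_mkcond; apply: eq_bigr => e _.
by rewrite /indic; case: ifP.
Qed.

Lemma vsum_indic M v : is_matching ends M -> vsum ends (indic M) v <= 1.
Proof.
move=> /is_matchingP mM; have [[e /andP[ve eM]]|ne] := pselect (exists e, incident ends v e && (e \in M)).
  rewrite /vsum (bigD1 e ve) /= {1}/indic eM big1 ?addr0 // => f /andP[vf fe].
  by rewrite /indic; case: (boolP (f \in M)) => // fM; move: fe; rewrite (mM f e v) ?eqxx.
rewrite /vsum big1 // => f vf; rewrite /indic; case: (boolP (f \in M)) => // fM.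
by case: ne; exists f; rewrite vf.
Qed.

Lemma indic_FM M : is_matching ends M -> FM ends (indic M).
Proof. by move=> mM; split => [e|v]; [rewrite /indic|exact: vsum_indic]. Qed.

Lemma bipartite_nu_star : nu_star ends R = (match_num ends)%:R.
Proof.
apply/eqP; rewrite eq_le; apply/andP; split.
  have [x [xFM <-]] := @FPM_nonempty R _ _ ends; exact: bipartite_match_num_ge.
have [M mM <-] := match_num_ex ends; rewrite -edge_sum_indic; apply: le_nu_star.
exact: indic_FM.
Qed.

Definition mix (lam : {set E} -> R) (e : E) : R := \sum_(M : {set E}) lam M * indic M e.

Let sum_mix lam (P : pred E) (c : E -> R) :
  \sum_(e | P e) mix lam e * c e = \sum_(M : {set E}) lam M * \sum_(e | P e) indic M e * c e.
Proof.
rewrite /mix (eq_bigr (fun e => \sum_(M : {set E}) lam M * (indic M e * c e))).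
  by rewrite exchange_big /=; apply: eq_bigr => M _; rewrite mulr_sumr.
by move=> e _; rewrite mulr_suml; apply: eq_bigr => M _; rewrite mulrA.
Qed.

Lemma mix_edge_sum lam : edge_sum (mix lam) = \sum_(M : {set E}) lam M * #|M|%:R.
Proof.
have := sum_mix lam xpredT (fun=> 1); rewrite /edge_sum.
under eq_bigr do rewrite mulr1; move=> ->; apply: eq_bigr => M _.
by rewrite -edge_sum_indic /edge_sum; under eq_bigr do rewrite mulr1.
Qed.

Definition simplex : set ({set E} -> R) :=
  [set lam | [/\ forall M, 0 <= lam M, forall M, ~~ is_matching ends M -> lam M = 0 &
     \sum_(M : {set E}) lam M = 1]].

Lemma PM_sub_FPM : PM (R := R) ends `<=` FPM (R := R) ends.
Proof.
move=> x [lam [lam0 lamM lam1 ->]]; have mixE : (fun e => \sum_(M : {set E}) lam M * (e \in M)%:R) = mix lam by [].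
rewrite mixE; split; last first.
  rewrite mix_edge_sum bipartite_nu_star -[RHS]mul1r -lam1 mulr_suml; apply: eq_bigr => M _.
  have [/andP[_ /eqP ->]//|/lamM ->] := boolP (max_matching ends M); by rewrite !mul0r.
split=> [e|v]; first by apply: sumr_ge0 => M _; rewrite mulr_ge0 // /indic.
have := sum_mix lam (incident ends v) (fun=> 1); rewrite /vsum.
under eq_bigr do rewrite mulr1; move=> ->; rewrite -[leRHS]lam1; apply: ler_sum => M _.
have [mM|/lamM ->] := boolP (max_matching ends M); last by rewrite mul0r.
rewrite -[leRHS]mulr1 ler_wpM2l //; under eq_bigr do rewrite mulr1.
by apply: vsum_indic; case/andP: mM.
Qed.

Lemma simplex_compact (ls : nat -> {set E} -> R) : (forall n, simplex (ls n)) ->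
  exists U : set_system nat, [/\ ProperFilter U, \oo `<=` U &
    exists2 lam, simplex lam & forall M, ls n M @[n --> U] --> lam M].
Proof.
move=> sls; have [U [PU sU Ulim]] := ultra_limit R; exists U; split => //.
have /choice[lam ll] : forall M, exists l : R, ls n M @[n --> U] --> l.
  move=> M; apply: (Ulim _ 0 1) => n; have [l0 _ l1] := sls n.
  by rewrite l0 -l1 (bigD1 M) //= lerDl sumr_ge0.
exists lam => //; split=> [M|M nM|].
- by apply: (cvg_ge _ (ll M)) => n; have [] := sls n.
- apply/eqP; rewrite eq_le; apply/andP; split.
    by apply: (cvg_le _ (ll M)) => n; have [_ H _] := sls n; rewrite H.
  by apply: (cvg_ge _ (ll M)) => n; have [] := sls n.
- have S : \sum_(M : {set E}) ls n M @[n --> U] --> \sum_(M : {set E}) lam M.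
    by apply: cvg_sumr => M _; exact: ll.
  apply/eqP; rewrite eq_le; apply/andP; split.
    by apply: (cvg_le _ S) => n; have [_ _ ->] := sls n.
  by apply: (cvg_ge _ S) => n; have [_ _ ->] := sls n.
Qed.

Variable x : E -> R.
Hypothesis xFM : FM ends x.

Let dist2 (lam : {set E} -> R) : R := \sum_e (x e - mix lam e) ^+ 2.

Let dirac_simplex M : is_matching ends M -> simplex (fun N => (N == M)%:R).
Proof.
move=> mM; split=> [N|N nN|]; first by [].
  by case: eqP => // NM; rewrite NM mM in nN.
by rewrite (bigD1 M) //= eqxx big1 ?addr0 // => N /negPf ->.
Qed.

Let nearest : exists2 lam, simplex lam & forall mu, simplex mu -> dist2 lam <= dist2 mu.
Proof.
pose D := [set dist2 lam | lam in simplex].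
have D0 : has_inf D.
  split; first by exists (dist2 (fun N => (N == finset.set0)%:R)); exists (fun N => (N == finset.set0)%:R) => //; apply: dirac_simplex; exact: is_matching0.
  by exists 0 => _ [lam _ <-]; apply: sumr_ge0 => e _; exact: sqr_ge0.
have h0 n : (0 : R) < harmonic n by rewrite invr_gt0 ltr0n.
have /choice[ls Hls] : forall n, exists lam, simplex lam /\ dist2 lam < inf D + harmonic n.
  by move=> n; have [_ [lam sl <-] H] := inf_adherent (h0 n) D0; exists lam.
have [|U [PU sU [lam sl ll]]] := @simplex_compact ls; first by move=> n; case: (Hls n).
exists lam => // mu smu.
have dl : dist2 (ls n) @[n --> U] --> dist2 lam.
  apply: cvg_sumr => e _.
  have me : x e - mix (ls n) e @[n --> U] --> x e - mix lam e.
    apply: cvgB; first exact: cvg_cst.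
    by apply: cvg_sumr => M _; apply: cvgM; [exact: ll|exact: cvg_cst].
  exact: (cvgM me me).
have hU : inf D + harmonic n @[n --> U] --> inf D + 0.
  apply: cvgD; first exact: cvg_cst.
  by move=> A /(@cvg_harmonic R) HA; exact: sU.
rewrite addr0 in hU.
apply: (@le_trans _ _ (inf D)).
  by apply: (ler_cvg_to dl hU); apply: nearW => n; apply: ltW; case: (Hls n).
by apply: ge_inf; [case: D0|exists mu].
Qed.

(* The Bethe bound with weights [exp (T w)] shows that no linear functional [w]
   separates [x] from the matchings; applied to the residual of the nearest
   convex combination, it forces that residual to vanish. *)
Lemma bipartite_matching_polytope : exists2 lam, simplex lam & x = mix lam.
Proof.
have [lam sl Hmin] := nearest; exists lam => //.
pose w e := x e - mix lam e.
have [lam0 lamM lam1] := sl.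
have obtuse M : is_matching ends M -> \sum_e w e * (indic M e - mix lam e) <= 0.
  move=> mM; set I := \sum_e _; pose C := \sum_e (indic M e - mix lam e) ^+ 2.
  rewrite leNgt; apply/negP => I0.
  have C0 : 0 <= C by apply: sumr_ge0 => e _; exact: sqr_ge0.
  (* Moving from [lam] towards [M] by [t] changes the squared distance by [- 2 t I + t^2 C]. This
     [t] is at most 1 and has [t C <= I], so the distance would strictly decrease. *)
  pose t := I / (I + C).
  have t0 : 0 < t by rewrite divr_gt0 // ltr_wpDr.
  have t1 : t <= 1 by rewrite ler_pdivrMr ?mul1r ?lerDl // ltr_wpDr.
  pose mu N := (1 - t) * lam N + t * (N == M)%:R.
  have smu : simplex mu.
    split=> [N|N nN|]; first by apply: addr_ge0; apply: mulr_ge0; rewrite ?subr_ge0 ?(ltW t0).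
      rewrite /mu lamM // mulr0 add0r; case: eqP => [NM|]; last by rewrite mulr0.
      by rewrite NM mM in nN.
    have [_ _ dM] := dirac_simplex mM.
    by rewrite big_split /= -!mulr_sumr lam1 dM !mulr1 subrK.
  have mixE e : mix mu e = mix lam e + t * (indic M e - mix lam e).
    have dE : \sum_(N : {set E}) (N == M)%:R * indic N e = indic M e.
      by rewrite (bigD1 M) //= eqxx mul1r big1 ?addr0 // => N /negPf ->; rewrite mul0r.
    rewrite /mix /mu; under eq_bigr do rewrite mulrDl -(mulrA (1 - t)) -(mulrA t).
    rewrite big_split /= -!mulr_sumr dE; set S := \sum_N _; by ring.
  have := Hmin mu smu.
  have -> : dist2 mu = dist2 lam - 2 * t * I + t ^+ 2 * C.
    rewrite /dist2 /I /C !mulr_sumr -sumrN -!big_split /=; apply: eq_bigr => e _.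
    by rewrite mixE /w; ring.
  have tI : t * (I + C) = I by rewrite /t divfK // gt_eqF // ltr_wpDr.
  have tt : t ^+ 2 * C <= t * I by rewrite expr2 -mulrA ler_pM2l // -[leRHS]tI ler_pM2l // lerDr ltW.
  have : 0 < t * I by rewrite mulr_gt0.
  lra.
(* By [obtuse] every matching has weight at most [exp (T w.mix)], while the Bethe bound gives at
   least [exp (T w.x + bethe)]. So [T] times the squared residual stays bounded. *)
have ww : \sum_e w e ^+ 2 <= 0.
  apply: (@le0_linear_bound _ _ (ln #|{set E}|%:R - bethe ends x)) => T T0.
  have c0 : (0 : R) < #|{set E}|%:R by rewrite ltr0n; apply/card_gt0P; exists finset.set0.
  have B := bethe_lower bip (fun e => expR_gt0 (T * w e)) xFM.
  have {}B : expR (\sum_e x e * ln (expR (T * w e)) + bethe ends x) <=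
     expR (ln #|{set E}|%:R + T * \sum_e w e * mix lam e).
    apply: le_trans B _; rewrite expRD lnK ?posrE // mulr_natl -sumr_const big_mkcond.
    apply: ler_sum => M _; case: ifP => [mM|_]; last exact: expR_ge0.
    rewrite -expR_sum ler_expR -mulr_sumr ler_pM2l // -subr_le0; apply: le_trans (obtuse M mM).
    under [leRHS]eq_bigr do rewrite mulrBr.
    rewrite [leRHS]sumrB lerD2r big_mkcond; apply: ler_sum => e _; rewrite /indic.
    by case: ifP; rewrite ?mulr1 ?mulr0.
  rewrite ler_expR in B.
  have E1 : \sum_e x e * ln (expR (T * w e)) = (\sum_e w e ^+ 2) * T + T * \sum_e w e * mix lam e.
    rewrite mulr_suml mulr_sumr -big_split /=; apply: eq_bigr => e _.
    by rewrite expRK /w; ring.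
  lra.
apply/funext => e; apply/eqP; rewrite -subr_eq0 -sqrf_eq0 eq_le sqr_ge0 andbT.
apply: le_trans ww; rewrite (bigD1 e) //= lerDl sumr_ge0 // => f _; exact: sqr_ge0.
Qed.
End Bipartite.

Section BipartiteFPM.
Variables (R : realType) (V E : finType) (ends : E -> V * V).
Hypothesis bip : bipartite_graph ends.

(** The size of [x] is an average of matching sizes and equals their maximum, so only maximum
    matchings carry mass. *)
Lemma bipartite_FPM : FPM (R := R) ends = PM (R := R) ends.
Proof.
apply/seteqP; split; last exact: PM_sub_FPM.
move=> x [xFM xnu]; have [lam [lam0 lamM lam1] xE] := bipartite_matching_polytope bip xFM.
exists lam; split => // M nM.
have [mM|/lamM //] := boolP (is_matching ends M).
have lt : (#|M| < match_num ends)%N.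
  by rewrite ltn_neqAle le_match_num // andbT; move: nM; rewrite /max_matching mM.
have S : \sum_(N : {set E}) lam N * ((match_num ends)%:R - #|N|%:R) = 0.
  under eq_bigr do rewrite mulrBr.
  rewrite sumrB -mulr_suml lam1 mul1r -(bipartite_nu_star R bip) -xnu {1}xE.
  by rewrite mix_edge_sum subrr.
have P0 (N : {set E}) : true -> 0 <= lam N * ((match_num ends)%:R - #|N|%:R).
  move=> _; have [mN|/lamM ->] := boolP (is_matching ends N); last by rewrite mul0r.
  by rewrite mulr_ge0 // subr_ge0 ler_nat le_match_num.
have /eqP := S; rewrite psumr_eq0 // => /allP /(_ M (mem_index_enum M)) /=.
by rewrite mulf_eq0 subr_eq0 eqr_nat (gtn_eqF lt) orbF => /eqP.
Qed.
End BipartiteFPM.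

Lemma bipartite_loopless (V E : finType) (ends : E -> V * V) :
  bipartite_graph ends -> loopless ends.
Proof. by move=> [c Hc] e; apply: contra (Hc e) => /eqP ->. Qed.

(** Holds for every lift, typical or not: the pullback of a point of [FPM] has size [n nu_star],
    which is exactly the matching number of the bipartite lift, so [bipartite_max_matchings] applies
    to the lift itself. *)
Lemma bipartite_lift_max_matchings (R : realType) (V E : finType) (ends : E -> V * V)
    (n : nat) (s : nlift E n) : bipartite_graph ends -> (0 < n)%N ->
  bethe_FPM R ends <=
    ln (nmatch (lift_ends ends s) (match_num (lift_ends ends s)))%:R / n%:R.
Proof.
move=> bip n0; have Hl := bipartite_loopless bip.
have nR : (0 : R) < n%:R by rewrite ltr0n.
have bipL := bipartite_lift s bip.
apply: ge_sup; first by have [x xF] := @FPM_nonempty R _ _ ends; exists (bethe ends x); exists x.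
move=> _ [x [xFM xnu] <-]; rewrite ler_pdivlMr // mulrC -(lift_bethe Hl s).
have xL := lift_FM Hl s xFM.
apply: (bipartite_max_matchings bipL xL); apply/eqP; rewrite eq_le bipartite_match_num_ge //=.
rewrite lift_edge_sum xnu mulrC -ler_pdivrMr //.
exact: match_num_le.
Qed.

Theorem theorem2p3 (R : realType) (V E : finType) (ends : E -> V * V)
  (Hloop : loopless ends) (Hconn : connected_graph ends)
  (d : measure_display) (Omega : measurableType d) (P : probability Omega R)
  (L : forall n : nat, Omega -> nlift E n)
  (Lmeas : forall (n : nat) (l : nlift E n), measurable (L n @^-1` [set l]))
  (Lunif : forall (n : nat) (l : nlift E n),
     P (L n @^-1` [set l]) = ((#|{: nlift E n}|%:R)^-1 : R)%:E) :
  [/\ {ae P, forall w, (fun n : nat =>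
          (match_num (lift_ends ends (L n w)))%:R / n%:R : R)
          @ \oo --> (nu_star ends R : R)},
      (forall z : R, 0 < z ->
        {ae P, forall w, (fun n : nat =>
          ln (match_poly (lift_ends ends (L n w)) z) / n%:R)
          @ \oo --> (sup [set edge_sum x * ln z + bethe ends x | x in FM (R:=R) ends] : R)}),
      {ae P, forall w,
        (limn_esup (fun n : nat =>
          (ln (nmatch (lift_ends ends (L n w))
                 (match_num (lift_ends ends (L n w))))%:R / n%:R)%:E)
         <= (sup [set bethe ends x | x in FPM (R:=R) ends])%:E)%E}
    & bipartite_graph ends ->
      FPM (R:=R) ends = PM (R:=R) ends /\
      {ae P, forall w, (fun n : nat =>
          ln (nmatch (lift_ends ends (L n w))
                 (match_num (lift_ends ends (L n w))))%:R / n%:R)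
          @ \oo --> (sup [set bethe ends x | x in PM (R:=R) ends] : R)}].
Proof.
have typ := typical_ae Hloop Lmeas Lunif.
split.
- by apply: filterS typ => w; exact: match_num_cvg.
- by move=> z z0; apply: filterS typ => w typ; exact: free_energy_cvg.
- by apply: filterS typ => w; exact: max_matchings_limsup.
move=> bip; split; first exact: bipartite_FPM.
rewrite -(bipartite_FPM R bip).
apply: filterS typ => w typ; apply/cvgrPdist_le => e e0.
have H := max_matchings_upper Hloop typ e0.
near=> n.
have n0 : (0 < n)%N by near: n; exists 1%N.
have h1 := bipartite_lift_max_matchings R (L n w) bip n0.
have h2 : ln (nmatch (lift_ends ends (L n w)) (match_num (lift_ends ends (L n w))))%:R / n%:R
    <= bethe_FPM R ends + e by near: n.
by rewrite -/(bethe_FPM R ends) ler_norml; apply/andP; split; lra.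
Unshelve. all: by end_near. Qed.
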